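(* Let $(M,g)$ be a closed Riemannian manifold and let $f:M\to\mathbb{C}$ be a $(\lambda,\mu)$-eigenfunction, $f$ not identically zero. Let $r_1<r_2\in[0,\infty]$. Then every connected component of $|f|^{-1}\big((r_1,r_2)\big)=\{x\in M\mid r_1<|f(x)|<r_2\}$ is either empty or has non-zero first Betti number.
   Context: Closed means compact without boundary. $\Delta=\operatorname{div}\nabla$ is the Laplace-Beltrami operator, extended complex-linearly; $g$ is extended complex-bilinearly to $T^{\mathbb{C}}M$ and $\kappa(\varphi,\psi)=g(\nabla\varphi,\nabla\psi)$. A smooth $f:M\to\mathbb{C}$ is a $(\lambda,\mu)$-eigenfunction ($\lambda,\mu\in\mathbb{C}$) if $\Delta f=\lambda f$ and $\kappa(f,f)=\mu f^2$.
   Formalization: The formal theorem also assumes that f is not locally constant (on connected M: not constant); without this the claim fails, e.g. f = 1 on the round sphere S^2 with r_1 = 0, r_2 = ∞, where the set is S^2 with first Betti number 0. *)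

(* Defs.v *)
(* {freeg K / G}, the free module on K, comes from multinomials. *)
From HB Require Import structures.
From mathcomp Require Import all_boot all_order all_algebra.
From mathcomp Require Import complex freeg.
From mathcomp Require Import all_classical all_reals all_analysis.
Set Implicit Arguments.
Unset Strict Implicit.
Unset Printing Implicit Defensive.
Import Order.TTheory GRing.Theory Num.Theory numFieldNormedType.Exports.
Local Open Scope classical_set_scope.
Local Open Scope ring_scope.
Local Open Scope complex_scope.

Section euclidean.
Variables (R : realType) (n : nat).
Implicit Types (A : set 'rV[R]_n) (u : 'rV[R]_n -> R).

Definition partial (i : 'I_n) u : 'rV[R]_n -> R :=
  fun x => 'D_(delta_mx 0 i) u x.

(* C^k on an open set A; the values of u outside A are irrelevant. *)
Fixpoint Ck_on (k : nat) A u : Prop :=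
  (forall x, A x -> {for x, continuous u}) /\
  if k is k'.+1 then
    forall i : 'I_n, (forall x, A x -> derivable u x (delta_mx 0 i)) /\
      Ck_on k' A (partial i u)
  else True.

Definition smooth_on A u := forall k, Ck_on k A u.

End euclidean.

Section manifold.
Variables (R : realType) (n : nat).

(* A homeomorphism from an open subset of M onto an open subset of R^n; both
   directions are given by total functions whose values outside of
   [chart_dom], resp. of its image, are irrelevant. *)
Record chart (M : topologicalType) := Chart {
  chart_dom : set M;
  chart_map :> M -> 'rV[R]_n;
  chart_inv : 'rV[R]_n -> M;
  chart_dom_open : open chart_dom;
  chart_img_open : open (chart_map @` chart_dom);
  chart_mapK : forall p, chart_dom p -> chart_inv (chart_map p) = p;
  chart_map_continuous : forall p, chart_dom p -> {for p, continuous chart_map};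
  chart_inv_continuous : forall x, (chart_map @` chart_dom) x ->
    {for x, continuous chart_inv} }.

Definition chart_img (M : topologicalType) (c : chart M) : set 'rV[R]_n :=
  c @` chart_dom c.

Record smooth_manifold := SmoothManifold {
  mfd_space :> topologicalType;
  mfd_hausdorff : hausdorff_space mfd_space;
  mfd_second_countable : @second_countable mfd_space;
  atlas : set (chart mfd_space);
  atlas_cover : forall p, exists2 c, atlas c & chart_dom c p;
  atlas_smooth : forall c d, atlas c -> atlas d -> forall k : 'I_n,
    smooth_on (c @` (chart_dom c `&` chart_dom d))
              (fun x => d (chart_inv c x) 0 k) }.

Definition smooth (M : smooth_manifold) (u : M -> R) :=
  forall c, atlas c -> smooth_on (chart_img c) (u \o chart_inv c).

(* J k l is the derivative of the l-th coordinate of d with respect to the k-th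
   coordinate of c, so that v |-> v *m J changes the components of a tangent
   vector from c to d. *)
Definition transition_jacobian (M : smooth_manifold) (c d : chart M)
    (x : 'rV[R]_n) : 'M[R]_n :=
  \matrix_(k, l) partial k (fun y => d (chart_inv c y) 0 l) x.

(* [metric c x] is the Gram matrix (g_kl) of the coordinate frame of the chart
   c at the point of coordinates x. *)
Record riemannian_metric (M : smooth_manifold) := RiemannianMetric {
  metric :> chart M -> 'rV[R]_n -> 'M[R]_n;
  metric_smooth : forall c, atlas c -> forall k l,
    smooth_on (chart_img c) (fun x => metric c x k l);
  metric_sym : forall c, atlas c -> forall x, chart_img c x ->
    (metric c x)^T = metric c x;
  metric_pos : forall c, atlas c -> forall x, chart_img c x ->
    forall v : 'rV[R]_n, v != 0 -> 0 < (v *m metric c x *m v^T) 0 0;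
  metric_compat : forall c d, atlas c -> atlas d ->
    forall p, chart_dom c p -> chart_dom d p ->
    let J := transition_jacobian c d (c p) in
    metric c (c p) = J *m metric d (d p) *m J^T }.

(* A closed manifold: compact, and without boundary since the charts take
   their values in open subsets of R^n. *)
Definition closed_manifold (M : smooth_manifold) := compact [set: M].

Section operators.
Variables (M : smooth_manifold) (g : riemannian_metric M).
Implicit Types (c : chart M) (u : 'rV[R]_n -> R) (f h : M -> R[i]).

(* Component k of the gradient is the sum over l of g^kl d_l u. *)
Definition grad c u (x : 'rV[R]_n) : 'rV[R]_n :=
  (\row_k partial k u x) *m invmx (g c x).

Definition volume_density c (x : 'rV[R]_n) : R := Num.sqrt (\det (g c x)).

Definition divergence c (X : 'rV[R]_n -> 'rV[R]_n) (x : 'rV[R]_n) : R :=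
  (volume_density c x)^-1 *
  \sum_k partial k (fun y => volume_density c y * X y 0 k) x.

Definition laplacian c u : 'rV[R]_n -> R := divergence c (grad c u).

Definition re_rep c f : 'rV[R]_n -> R := fun x => complex.Re (f (chart_inv c x)).
Definition im_rep c f : 'rV[R]_n -> R := fun x => complex.Im (f (chart_inv c x)).

Definition complex_grad c f (x : 'rV[R]_n) : 'rV[R[i]]_n :=
  \row_k (grad c (re_rep c f) x 0 k +i* grad c (im_rep c f) x 0 k).

Definition complex_laplacian c f (x : 'rV[R]_n) : R[i] :=
  laplacian c (re_rep c f) x +i* laplacian c (im_rep c f) x.

Definition kappa c f h (x : 'rV[R]_n) : R[i] :=
  (complex_grad c f x *m map_mx (real_complex R) (g c x)
     *m (complex_grad c h x)^T) 0 0.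

Definition smooth_complex f :=
  smooth (fun p => complex.Re (f p)) /\ smooth (fun p => complex.Im (f p)).

(* The Laplacian and kappa do not depend on the coordinates, so the equations
   are imposed in every chart of the atlas. *)
Definition eigenfunction (lambda mu : R[i]) f :=
  smooth_complex f /\
  forall c, atlas c -> forall p, chart_dom c p ->
    complex_laplacian c f (c p) = lambda * f p /\
    kappa c f f (c p) = mu * f p ^+ 2.

End operators.

End manifold.

Section betti.
Variable R : realType.

Definition std_simplex (k : nat) : set 'rV[R]_k.+1 :=
  [set t | (forall i, 0 <= t 0 i) /\ \sum_i t 0 i = 1].
Arguments std_simplex k : clear implicits.

Definition face_fun k (i : 'I_k.+2) (t : 'rV[R]_k.+1) : 'rV[R]_k.+2 :=
  \row_j (if unlift i j is Some l then t 0 l else 0).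

Lemma face_subproof k (i : 'I_k.+2) (t : std_simplex k) :
  face_fun i (val t) \in std_simplex k.+1.
Proof.
case: t => t /= /set_mem[t_ge0 t_sum1]; apply/mem_set; split=> [j|].
  by rewrite mxE; case: (unlift i j).
rewrite (bigD1_ord i) //= mxE unlift_none add0r -t_sum1.
by apply: eq_bigr => j _; rewrite mxE liftK.
Qed.

Definition face k (i : 'I_k.+2) (t : std_simplex k) : std_simplex k.+1 :=
  exist _ (face_fun i (val t)) (face_subproof i t).

Lemma face_continuous k (i : 'I_k.+2) :
  continuous (face i : std_simplex k -> std_simplex k.+1).
Proof.
apply: continuous_comp_initial => t A [P Pt PA].
have PA' : [set u : std_simplex k | forall ab, P ab.1 ab.2 (face_fun i (val u) ab.1 ab.2)]
    `<=` (set_val \o face i) @^-1` A.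
  by move=> u /= h; apply: PA => a b; exact: (h (a, b)).
apply: (@filterS _ (nbhs t) _ _ _ PA').
apply: (@filter_forall _ ('I_1 * 'I_k.+2)%type _ (nbhs t)) => -[a b] /=.
have := Pt a b; rewrite /= !mxE; case e: (unlift i b) => [l|] h.
  have : continuous ((fun N : 'rV[R]_k.+1 => N 0 l) \o
                      (set_val : std_simplex k -> 'rV[R]_k.+1)).
    move=> u; apply: continuous_comp; last exact: coord_continuous.
    exact: initial_continuous.
  by move=> /(_ t _ h); apply: (@filterS _ (nbhs t)) => u; rewrite /= mxE e.
by apply: nearW => u; rewrite /= !mxE e; exact: nbhs_singleton h.
Qed.

HB.instance Definition _ k (i : 'I_k.+2) :=
  isContinuous.Build _ _ (face i) (@face_continuous k i).

Variable X : topologicalType.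

Definition singular_simplex k := continuousType (std_simplex k) X.

Definition simplex_face k (i : 'I_k.+2) (s : singular_simplex k.+1) :
    singular_simplex k := s \o face i.

Definition chain k := {freeg (singular_simplex k) / rat}.

Definition boundary k : chain k.+1 -> chain k :=
  fglift (fun s => \sum_(i < k.+2) (-1) ^+ i *: << simplex_face i s >>).

Definition independent_classes m (z : 'I_m -> chain 1) :=
  (forall i, boundary (z i) = 0) /\
  forall a : 'I_m -> rat,
    (exists b : chain 2, boundary b = \sum_i a i *: z i) -> forall i, a i = 0.

(* dim_Q H_1(X; Q), possibly +oo *)
Definition betti1 : \bar R :=
  ereal_sup [set (m%:R)%:E | m in
    [set m : nat | exists z : 'I_m -> chain 1, independent_classes z]].

End betti.

(* Main.v *)
Require Import Defs.
From HB Require Import structures.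
From mathcomp Require Import all_boot all_order all_algebra.
From mathcomp Require Import complex freeg ring lra.
From mathcomp Require Import all_classical all_reals all_analysis.
Import Order.TTheory GRing.Theory Num.Theory numFieldNormedType.Exports.
Local Open Scope classical_set_scope.
Local Open Scope ring_scope.
Local Open Scope complex_scope.
Set Implicit Arguments.
Unset Strict Implicit.
Unset Printing Implicit Defensive.

(* Write f = exp (u + i theta) where f does not vanish; |grad u|^2 - |grad theta|^2
   = Re mu and 2 g(grad u, grad theta) = Im mu.  At a maximum of |f| the gradient
   of u vanishes, so mu is real and mu <= 0.

   If mu = 0, then df = 0 at that maximum, and expanding kappa(f, f) = 0 to second
   order along lines shows that the Hessian H satisfies H g^-1 H = 0; hence
   g^-1 H is nilpotent, its trace (Delta f)(p) = lambda f(p) vanishes, so f is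
   harmonic and, by Hopf's strong maximum principle, locally constant.

   If mu < 0, then |grad theta|^2 >= - mu > 0 wherever f does not vanish.  When
   H_1(C; Q) = 0 the function theta is globally defined on C: theta(x) is the
   variation of arg f along any rational 1-chain with boundary x - x0, and this
   variation is zero on boundaries.  For r1 < s1 < s2 < r2, the function
   (|f|^2 - s1^2) (s2^2 - |f|^2) exp theta has a maximum over the compact set of
   points of C where s1 <= |f| <= s2, at an interior point since it vanishes on
   the edges.  There, grad theta is a multiple of grad u, to which it is
   orthogonal, hence grad theta = 0: a contradiction. *)

Local Notation ex_derive_of d := (@ex_derive _ _ _ _ _ _ _ d).
Local Notation derive_val_of d := (@derive_val _ _ _ _ _ _ _ d).

(** * Directional derivatives *)

Section directional.
Variables (R : realType) (V : normedModType R).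
Implicit Types (u : V -> R) (x v w : V).

Lemma is_derive_line u x v (t : R) : derivable u (x + t *: v) v ->
  is_derive t 1 (fun s : R => u (x + s *: v)) ('D_v u (x + t *: v)).
Proof.
have E : (fun h : R => h^-1 *: (((fun s : R => u (x + s *: v)) \o shift t) (h *: 1)
      - u (x + t *: v)))
   = (fun h : R => h^-1 *: ((u \o shift (x + t *: v)) (h *: v) - u (x + t *: v))).
  apply/funext => h /=; congr (_ *: (u _ - _)).
  by rewrite [h%:A]mulr1 scalerDl addrCA.
by move=> du; split; rewrite /derivable /derive E.
Qed.

Lemma is_derive_scale u x v (c : R) : derivable u x v ->
  is_derive x (c *: v) u (c * 'D_v u x).
Proof.
have [->|c0] := eqVneq c 0; first by rewrite scale0r mul0r => _; exact: is_derive0.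
move=> du.
have : (fun h : R => h^-1 *: ((u \o shift x) (h *: (c *: v)) - u x)) @ 0^' -->
       c * 'D_v u x.
  have -> : (fun h : R => h^-1 *: ((u \o shift x) (h *: (c *: v)) - u x)) =
     (fun h => c *: h) \o
     (fun k => k^-1 *: ((u \o shift x) (k *: v) - u x)) \o (fun h => c * h).
    apply/funext => h /=; rewrite !scalerA invfM mulrA mulfV // mul1r.
    by rewrite [h * c]mulrC.
  apply: (@cvg_comp _ _ _ ((fun k : R => k^-1 *: ((u \o shift x) (k *: v) - u x))
    \o (fun h => c * h)) (fun h => c *: h) _ (nbhs ('D_v u x))); last first.
    exact: scaler_continuous.
  apply: cvg_comp du.
  move=> A [e /= e0 eA]; exists (e / `|c|) => /=; first by rewrite divr_gt0 ?normr_gt0.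
  move=> h /=; rewrite sub0r normrN => he h0; apply: eA => /=.
    by rewrite sub0r normrN normrM mulrC -ltr_pdivlMr ?normr_gt0.
  by rewrite mulf_neq0.
by move=> H; split; [apply/cvg_ex; eexists; exact: H|exact: cvg_lim H].
Qed.

Lemma directional_mvt u x v :
  (forall s : R, 0 <= s <= 1 -> derivable u (x + s *: v) v) ->
  exists2 s : R, 0 < s < 1 & u (x + v) - u x = 'D_v u (x + s *: v).
Proof.
move=> du.
have dI (s : R) : 0 <= s <= 1 ->
  is_derive s 1 (fun s : R => u (x + s *: v)) ('D_v u (x + s *: v)).
  by move=> s01; apply: is_derive_line; exact: du.
have dO (s : R) : s \in `]0, 1[ ->
  is_derive s 1 (fun s : R => u (x + s *: v)) ('D_v u (x + s *: v)).
  by rewrite in_itv/= => /andP[/ltW s0 /ltW s1]; apply: dI; rewrite s0.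
have cI : {within `[0, 1], continuous (fun s : R => u (x + s *: v))}.
  apply: derivable_within_continuous => s; rewrite in_itv/= => sI.
  exact: (ex_derive_of (dI s sI)).
have [s sI] := MVT ltr01 dO cI.
rewrite scale1r scale0r addr0 subr0 mulr1 => ->.
by exists s => //; move: sI; rewrite in_itv.
Qed.

Lemma is_derive_add_dir u x v w a : is_derive x v u a ->
  (\forall y \near x, derivable u y w) -> {for x, continuous ('D_w u)} ->
  is_derive x (v + w) u (a + 'D_w u x).
Proof.
move=> [du ua] dw cw.
suff H : (fun h : R => h^-1 *: ((u \o shift x) (h *: (v + w)) - u x)) @ 0^' -->
       a + 'D_w u x.
  by split; [apply/cvg_ex; eexists; exact: H|exact: cvg_lim H].
have -> : (fun h : R => h^-1 *: ((u \o shift x) (h *: (v + w)) - u x)) =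
     (fun h : R => h^-1 *: ((u \o shift x) (h *: v) - u x)) +
     (fun h : R => h^-1 *: (u (h *: v + x + h *: w) - u (h *: v + x))).
  apply/funext => h /=; rewrite [RHS]/GRing.add/= -scalerDr; congr (_ *: _).
  by rewrite scalerDr addrAC [X in _ = X]addrC addrA subrK.
apply: cvgD; first (rewrite -ua; exact: du).
apply/cvgrPdist_le => e e0.
have : \forall y \near x, derivable u y w /\ `|'D_w u x - 'D_w u y| <= e.
  near=> y; split; first by near: y.
  by near: y; move/cvgrPdist_le : cw => /(_ _ e0).
move=> /nbhs_normP[d /= d0 dP].
have c0 : 0 < `|v| + `|w| + 1 by rewrite ltr_wpDl// addr_ge0.
near=> h.
have h0 : h != 0 by near: h; exact: nbhs_dnbhs_neq.
have hd : `|h| < d / (`|v| + `|w| + 1).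
  by near: h; apply: dnbhs0_lt; rewrite divr_gt0.
have near_x (s : R) : 0 <= s <= 1 ->
    ball_ Num.norm x d (h *: v + x + s *: (h *: w)).
  move=> /andP[s0 s1]; rewrite /= distrC addrAC addrK.
  rewrite scalerA mulrC -scalerA -scalerDr normrZ.
  rewrite (le_lt_trans _ (_ : `|h| * (`|v| + `|w| + 1) < d)) -?ltr_pdivlMr//.
  rewrite ler_wpM2l// (le_trans (ler_normD _ _))// -addrA lerD2l.
  by rewrite normrZ ger0_norm// ler_wpDr// ler_piMl.
have [|s /andP[/ltW s0 /ltW s1] ->] := @directional_mvt u (h *: v + x) (h *: w).
  by move=> s s01; have [dy _] := dP _ (near_x s s01); exact: (ex_derive_of (is_derive_scale h dy)).
have [|dy uy] := dP _ (near_x s _); first by rewrite s0.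
rewrite (derive_val_of (is_derive_scale h dy)).
by rewrite [_ *: _]mulrA mulVf // mul1r.
Unshelve. all: by end_near. Qed.

End directional.

Section second_order.
Variables (R : realType) (V : normedModType R).
Implicit Types (u : V -> R) (x v w : V).

Lemma near_line (P : V -> Prop) x v : (\forall y \near x, P y) ->
  exists2 d : R, 0 < d & forall t : R, `|t| < d -> P (x + t *: v).
Proof.
move=> /nbhs_normP[e /= e0 eP].
have c0 : 0 < `|v| + 1 by rewrite ltr_wpDl.
exists (e / (`|v| + 1)) => [|t]; first by rewrite divr_gt0.
rewrite ltr_pdivlMr// => te; apply: eP => /=.
rewrite opprD addNKr normrN normrZ (le_lt_trans _ te)// ler_wpM2l// lerDl//.
Qed.

Lemma derive_local_max u x v : (\forall y \near x, u y <= u x) ->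
  (\forall y \near x, derivable u y v) -> 'D_v u x = 0.
Proof.
move=> ux du.
have : \forall y \near x, u y <= u x /\ derivable u y v by apply: filterI.
move=> /(near_line v)[d d0 dP].
have dI (t : R) : t \in `](- d), d[ ->
  is_derive t 1 (fun s : R => u (x + s *: v)) ('D_v u (x + t *: v)).
  rewrite in_itv/= => td; apply: is_derive_line.
  by have [] := dP t; rewrite ?ltr_norml.
have : is_derive (0 : R) 1 (fun s : R => u (x + s *: v)) 0.
  apply: (@derive1_at_max _ _ (- d) d).
  - by apply: le_trans (ltW d0); rewrite oppr_le0 ltW.
  - by move=> t /dI tI; exact: (ex_derive_of tI).
  - by rewrite in_itv/= oppr_lt0 d0.
  - move=> t; rewrite in_itv/= => td; rewrite scale0r addr0.
    by have [] := dP t; rewrite ?ltr_norml.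
have := dI 0; rewrite in_itv/= oppr_lt0 d0 => /(_ isT).
by rewrite scale0r addr0 => -[_ <-] [_ ->].
Qed.

Lemma derive2_local_max u x v : (\forall y \near x, u y <= u x) ->
  (\forall y \near x, derivable u y v) -> derivable ('D_v u) x v ->
  'D_v ('D_v u) x <= 0.
Proof.
move=> ux du d2; rewrite leNgt; apply/negP => D2.
have D1 := derive_local_max ux du.
have [e e0 eP] : exists2 e : R, 0 < e & forall t : R, 0 < t < e ->
    0 < 'D_v u (x + t *: v).
  move/cvgrPdist_lt : (d2) => /(_ _ D2); rewrite -/(derive _ _ _).
  move=> /nbhs_normP[e /= e0 eP]; exists e => // t /andP[t0 te].
  have := eP t; rewrite /= sub0r normrN gtr0_norm// => /(_ te).
  rewrite gt_eqF// => /(_ isT).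
  rewrite D1 subr0 [t *: v + x]addrC => /(le_lt_trans (ler_norm _)).
  by rewrite gtrBl pmulr_rgt0// invr_gt0.
have : \forall y \near x, u y <= u x /\ derivable u y v by apply: filterI.
move=> /(near_line v)[d d0 dP].
pose t := Num.min d e / 2.
have t0 : 0 < t by rewrite divr_gt0// lt_min d0.
have [td te] : t < d /\ t < e.
  by apply/andP; rewrite -lt_min /t gtr_pMr ?lt_min ?d0// invf_lt1// ltr1n.
have dt (s : R) : 0 <= s <= 1 -> derivable u (x + s *: (t *: v)) (t *: v).
  move=> /andP[s0 s1].
  have [|_ dy] := dP (s * t).
    by rewrite normrM !ger0_norm// ?(ltW t0)// (le_lt_trans _ td)// ler_piMl// ltW.
  by rewrite scalerA; exact: (ex_derive_of (is_derive_scale t dy)).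
have [s /andP[s0 s1]] := directional_mvt dt.
have sd : 0 < s * t < e.
  by rewrite mulr_gt0//= (lt_trans _ te)// gtr_pMl.
have [|_ dy] := dP (s * t).
  by case/andP: sd => sd _; rewrite gtr0_norm// (lt_trans _ td)// gtr_pMl.
rewrite scalerA (derive_val_of (is_derive_scale t dy)) => E.
have [|] := dP t; first by rewrite gtr0_norm.
by rewrite -subr_le0 E leNgt mulr_gt0// eP.
Qed.

Lemma second_difference_cvg u x v w :
  (\forall y \near x, derivable u y v) ->
  (\forall y \near x, derivable ('D_v u) y w) ->
  {for x, continuous ('D_w ('D_v u))} ->
  h^-1 * h^-1 * (u (x + h *: v + h *: w) - u (x + h *: v) - u (x + h *: w) + u x)
    @[h --> 0^'] --> 'D_w ('D_v u) x.
Proof.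
move=> dv dw cw.
apply/cvgrPdist_le => e e0.
have : \forall y \near x, [/\ derivable u y v, derivable ('D_v u) y w &
   `|'D_w ('D_v u) x - 'D_w ('D_v u) y| <= e].
  have nw : \forall y \near x, `|'D_w ('D_v u) x - 'D_w ('D_v u) y| <= e.
    by move/cvgrPdist_le : cw => /(_ _ e0).
  by apply: filterS3 dv dw nw => y h1 h2 h3; split; [exact: h1|exact: h2|exact: h3].
move=> /nbhs_normP[d /= d0 dP].
have c0 : 0 < `|v| + `|w| + 1 by rewrite ltr_wpDl// addr_ge0.
near=> h.
have h0 : h != 0 by near: h; exact: nbhs_dnbhs_neq.
have hd : `|h| < d / (`|v| + `|w| + 1).
  by near: h; apply: dnbhs0_lt; rewrite divr_gt0.
have near_x (s t : R) : 0 <= s <= 1 -> 0 <= t <= 1 ->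
    ball_ Num.norm x d (x + s *: (h *: v) + t *: (h *: w)).
  move=> /andP[s0 s1] /andP[t0 t1]; rewrite /= distrC [x + _]addrC addrAC addrK.
  rewrite [s *: _]scalerA [t *: _]scalerA [s * h]mulrC [t * h]mulrC -!scalerA -scalerDr normrZ.
  rewrite (le_lt_trans _ (_ : `|h| * (`|v| + `|w| + 1) < d)) -?ltr_pdivlMr//.
  rewrite ler_wpM2l// (le_trans (ler_normD _ _))// ler_wpDr// lerD//.
    by rewrite normrZ ger0_norm// ler_piMl.
  by rewrite normrZ ger0_norm// ler_piMl.
pose g y := u (y + h *: w) - u y.
have dg (s : R) : 0 <= s <= 1 -> is_derive (x + s *: (h *: v)) (h *: v) g
    (h * ('D_v u (x + s *: (h *: v) + h *: w) - 'D_v u (x + s *: (h *: v)))).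
  move=> s01.
  have [d1 _ _] := dP _ (near_x s 1 s01 (introT andP (conj ler01 (lexx _)))).
  have [d2 _ _] := dP _ (near_x s 0 s01 (introT andP (conj (lexx _) ler01))).
  rewrite scale1r in d1; rewrite scale0r addr0 in d2.
  rewrite mulrBr; apply: is_deriveB; last exact: is_derive_scale.
  have [q1 q2] := is_derive_scale h d1.
  have E : (fun k : R => k^-1 *: (((fun y => u (y + h *: w)) \o shift (x + s *: (h *: v)))
        (k *: (h *: v)) - u (x + s *: (h *: v) + h *: w))) =
     (fun k : R => k^-1 *: ((u \o shift (x + s *: (h *: v) + h *: w))
        (k *: (h *: v)) - u (x + s *: (h *: v) + h *: w))).
    by apply/funext => k /=; congr (_ *: (u _ - _)); rewrite [RHS]addrA.
  by split; rewrite /derivable /derive E.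
have [|s /andP[/ltW s0 /ltW s1]] := @directional_mvt _ _ g x (h *: v).
  by move=> s s01; exact: (ex_derive_of (dg s s01)).
have s01 : 0 <= s <= 1 by rewrite s0.
rewrite (derive_val_of (dg s s01)) {1}/g /g.
have dt (t : R) : 0 <= t <= 1 -> derivable ('D_v u)
    (x + s *: (h *: v) + t *: (h *: w)) (h *: w).
  move=> t01; have [_ d1 _] := dP _ (near_x s t s01 t01).
  exact: (ex_derive_of (is_derive_scale h d1)).
have [t /andP[/ltW t0 /ltW t1] ->] := directional_mvt dt.
have [|_ d1 d2] := dP _ (near_x s t s01 _); first by rewrite t0.
rewrite (derive_val_of (is_derive_scale h d1)) => E.
rewrite -[X in h^-1 * h^-1 * X]addrA [X in h^-1 * h^-1 * (_ + X)]addrC.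
rewrite [_ - u (x + _)]addrC opprB in E *.
rewrite (_ : _ + _ + _ = h * (h * 'D_w ('D_v u) (x + s *: (h *: v) + t *: (h *: w)))); last first.
  by rewrite -E; ring.
by rewrite mulrACA mulrA mulVf// mul1r mulrA mulVf// mul1r.
Unshelve. all: by end_near. Qed.

Lemma derive_comm u x v w :
  (\forall y \near x, derivable u y v) -> (\forall y \near x, derivable u y w) ->
  (\forall y \near x, derivable ('D_v u) y w) ->
  (\forall y \near x, derivable ('D_w u) y v) ->
  {for x, continuous ('D_w ('D_v u))} -> {for x, continuous ('D_v ('D_w u))} ->
  'D_w ('D_v u) x = 'D_v ('D_w u) x.
Proof.
move=> dv dw dvw dwv cvw cwv.
have h1 := second_difference_cvg dv dvw cvw.
have := second_difference_cvg dw dwv cwv.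
have -> : (fun h : R => h^-1 * h^-1 *
   (u (x + h *: w + h *: v) - u (x + h *: w) - u (x + h *: v) + u x)) =
  (fun h : R => h^-1 * h^-1 *
   (u (x + h *: v + h *: w) - u (x + h *: v) - u (x + h *: w) + u x)).
  by apply/funext => h; rewrite [x + h *: w + _]addrAC; ring.
by move=> /(cvg_unique _ h1); apply; exact: Rhausdorff.
Qed.

End second_order.

(** * Functions of class C^k *)

Lemma is_derive_comp_scalar (R : realType) (V : normedModType R) (u : V -> R)
    (g : R -> R) (x v : V) (a b : R) :
  is_derive x v u a -> is_derive (u x) 1 g b ->
  is_derive x v (fun y => g (u y)) (b * a).
Proof.
move=> [du ua] dg.
have d0 : is_derive (0 : R) 1 (fun s : R => u (x + s *: v)) a.
  have x0 : x + (0 : R) *: v = x by rewrite scale0r addr0.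
  have := @is_derive_line _ _ u x v 0; rewrite x0 ua; apply; exact: du.
have dg0 : is_derive (u (x + (0 : R) *: v)) 1 g b.
  by rewrite scale0r addr0; exact: dg.
have [q1 q2] := is_derive1_comp dg0 d0.
have E : (fun h : R => h^-1 *: (((fun y => g (u y)) \o shift x) (h *: v) - g (u x))) =
   (fun h : R => h^-1 *: (((fun s : R => g (u (x + s *: v))) \o shift 0) (h *: 1)
      - g (u (x + 0 *: v)))).
  by apply/funext => h /=; rewrite scale0r !addr0 [h%:A]mulr1 [x + _]addrC.
by split; rewrite /derivable /derive E.
Qed.

Lemma near_eq_continuous (T U : topologicalType) (u w : T -> U) (x : T) :
  (\forall y \near x, u y = w y) -> {for x, continuous u} ->
  {for x, continuous w}.
Proof.
move=> uw cu; rewrite /prop_for /continuous_at -(nbhs_singleton uw).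
by apply: cvg_trans cu; exact: near_eq_cvg.
Qed.

Section Ck_closure.
Variables (R : realType) (n : nat) (A : set 'rV[R]_n).
Hypothesis Aopen : open A.
Implicit Types (u w : 'rV[R]_n -> R) (x v : 'rV[R]_n).

Lemma near_open x : A x -> \forall y \near x, A y.
Proof. by move=> Ax; exact: open_nbhs_nbhs. Qed.

Lemma Ck_on_continuous k u x : Ck_on k A u -> A x -> {for x, continuous u}.
Proof. by case: k => [|k] [] h _; exact: h. Qed.

Lemma Ck_on_derivable k u x (i : 'I_n) : Ck_on k.+1 A u -> A x ->
  derivable u x (delta_mx 0 i).
Proof. by case=> _ /(_ i)[+ _] => h; exact: h. Qed.

Lemma Ck_on_is_partial k u x (i : 'I_n) : Ck_on k.+1 A u -> A x ->
  is_derive x (delta_mx 0 i) u (partial i u x).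
Proof. by move=> uk Ax; apply/derivableP; exact: Ck_on_derivable uk Ax. Qed.

Lemma Ck_on_partial k u (i : 'I_n) : Ck_on k.+1 A u -> Ck_on k A (partial i u).
Proof. by case=> _ /(_ i)[]. Qed.

Lemma Ck_onW k u : Ck_on k.+1 A u -> Ck_on k A u.
Proof.
elim: k u => [|k IH] u [cu du]; split => // i.
by have [d1 /IH d2] := du i.
Qed.

Lemma Ck_on_ext k u w : {in A, u =1 w} -> Ck_on k A u -> Ck_on k A w.
Proof.
elim: k u w => [|k IH] u w uw.
  by move=> [cu _]; split=> // x Ax; apply: near_eq_continuous (cu x Ax);
    apply: filterS (near_open Ax) => y Ay; rewrite uw ?inE.
move=> [cu du].
have N x : A x -> \forall y \near x, u y = w y.
  by move=> Ax; apply: filterS (near_open Ax) => y Ay; rewrite uw ?inE.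
split=> [x Ax|i]; first by apply: near_eq_continuous (cu x Ax); exact: N.
have [d1 d2] := du i; split=> [x Ax|].
  by apply: near_eq_derivable (d1 x Ax); exact: N.
apply: IH d2 => x; rewrite inE => Ax; apply: near_eq_derive; exact: N.
Qed.

Lemma Ck_on_intro k u (du : 'I_n -> 'rV[R]_n -> R) :
  (forall x, A x -> {for x, continuous u}) ->
  (forall i x, A x -> is_derive x (delta_mx 0 i) u (du i x)) ->
  (forall i, Ck_on k A (du i)) -> Ck_on k.+1 A u.
Proof.
move=> cu Du duk; split=> // i; split=> [x Ax|].
  exact: (ex_derive_of (Du i x Ax)).
apply: Ck_on_ext (duk i) => x; rewrite inE => Ax.
by rewrite /partial (derive_val_of (Du i x Ax)).
Qed.

Lemma Ck_on_cst k (c : R) : Ck_on k A (fun _ => c).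
Proof.
elim: k c => [|k IH] c; first by split=> // x _; exact: cst_continuous.
apply: (@Ck_on_intro _ _ (fun _ _ => 0)) => // x; first by move=> _; exact: cst_continuous.
Qed.

Lemma Ck_on_add k u w : Ck_on k A u -> Ck_on k A w ->
  Ck_on k A (fun x => u x + w x).
Proof.
elim: k u w => [|k IH] u w uk wk.
  split=> // x Ax.
  by apply: continuousD; [case: uk => + _; apply|case: wk => + _; apply].
apply: (@Ck_on_intro _ _ (fun i x => partial i u x + partial i w x)) => [x Ax|i x Ax|i].
- by apply: continuousD; [case: uk => + _; apply|case: wk => + _; apply].
- exact: (is_deriveD (Ck_on_is_partial i uk Ax) (Ck_on_is_partial i wk Ax)).
- by apply: IH; exact: Ck_on_partial.
Qed.

Lemma Ck_on_mul k u w : Ck_on k A u -> Ck_on k A w ->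
  Ck_on k A (fun x => u x * w x).
Proof.
elim: k u w => [|k IH] u w uk wk.
  split=> // x Ax.
  by apply: continuousM; [case: uk => + _; apply|case: wk => + _; apply].
apply: (@Ck_on_intro _ _ (fun i x => u x * partial i w x + w x * partial i u x)) => [x Ax|i x Ax|i].
- by apply: continuousM; [case: uk => + _; apply|case: wk => + _; apply].
- exact: (is_deriveM (Ck_on_is_partial i uk Ax) (Ck_on_is_partial i wk Ax)).
- apply: Ck_on_add; apply: IH; (try exact: Ck_onW); exact: Ck_on_partial.
Qed.

Lemma Ck_on_sum k I (r : seq I) (P : pred I) (u : I -> 'rV[R]_n -> R) :
  (forall i, Ck_on k A (u i)) -> Ck_on k A (fun x => \sum_(i <- r | P i) u i x).
Proof.
move=> uk; elim: r => [|i r IH].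
  by under eq_fun do rewrite big_nil; exact: Ck_on_cst.
under eq_fun do rewrite big_cons.
by case: (P i) => //; apply: Ck_on_add.
Qed.

Lemma Ck_on_prod k I (r : seq I) (P : pred I) (u : I -> 'rV[R]_n -> R) :
  (forall i, Ck_on k A (u i)) -> Ck_on k A (fun x => \prod_(i <- r | P i) u i x).
Proof.
move=> uk; elim: r => [|i r IH].
  by under eq_fun do rewrite big_nil; exact: Ck_on_cst.
under eq_fun do rewrite big_cons.
by case: (P i) => //; apply: Ck_on_mul.
Qed.

Lemma Ck_on_opp k u : Ck_on k A u -> Ck_on k A (fun x => - u x).
Proof.
move=> uk; have := Ck_on_mul (Ck_on_cst k (-1)) uk.
by under eq_fun do rewrite mulN1r.
Qed.

Lemma Ck_on_inv k u : (forall x, A x -> u x != 0) ->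
  Ck_on k A u -> Ck_on k A (fun x => (u x)^-1).
Proof.
move=> u0; elim: k => [|k IH] uk.
  by split=> // x Ax; apply: continuousV; [exact: u0|case: uk => + _; apply].
apply: (@Ck_on_intro _ _ (fun i x => - ((u x)^-1 * (u x)^-1) * partial i u x)) => [x Ax|i x Ax|i].
- by apply: continuousV; [exact: u0|case: uk => + _; apply].
- have dux : derivable u x (delta_mx 0 i) := Ck_on_derivable uk Ax.
  split; first exact: derivableV (u0 x Ax) dux.
  rewrite (deriveV (u0 x Ax) dux) -invfM -expr2; exact: erefl.
- apply: Ck_on_mul (Ck_on_partial _ uk).
  by apply/Ck_on_opp/Ck_on_mul; apply/IH/Ck_onW.
Qed.

Lemma Ck_on_sqrt k u : (forall x, A x -> 0 < u x) ->
  Ck_on k A u -> Ck_on k A (fun x => Num.sqrt (u x)).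
Proof.
move=> u0; elim: k => [|k IH] uk.
  split=> // x Ax; apply: continuous_comp; last exact: sqrt_continuous.
  by case: uk => + _; apply.
apply: (@Ck_on_intro _ _ (fun i x => (2 * Num.sqrt (u x))^-1 * partial i u x)) => [x Ax|i x Ax|i].
- apply: continuous_comp; last exact: sqrt_continuous.
  by case: uk => + _; apply.
- apply: (is_derive_comp_scalar (Ck_on_is_partial i uk Ax)).
  exact/is_derive1_sqrt/u0.
- apply: Ck_on_mul (Ck_on_partial _ uk); apply: Ck_on_inv => [x Ax|].
    by rewrite mulf_neq0 ?pnatr_eq0// gt_eqF// sqrtr_gt0 u0.
  by apply: Ck_on_mul (Ck_on_cst _ _) _; apply/IH/Ck_onW.
Qed.

Lemma partial_coord (i j : 'I_n) x :
  is_derive x (delta_mx 0 i) (fun y : 'rV[R]_n => y 0 j) ((i == j)%:R).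
Proof.
have E : (fun h : R => h^-1 *: (((fun y : 'rV[R]_n => y 0 j) \o shift x)
    (h *: delta_mx 0 i) - x 0 j)) @ 0^' --> ((i == j)%:R : R).
  apply: cvg_near_cst; near=> h.
  rewrite /= !mxE eqxx /= addrK eq_sym.
  have h0 : h != 0 by near: h; exact: nbhs_dnbhs_neq.
  by rewrite [_ *: _]mulrA mulVf// mul1r.
by split; [apply/cvg_ex; eexists; exact: E|exact: cvg_lim E].
Unshelve. all: by end_near. Qed.

Lemma Ck_on_coord k (j : 'I_n) : Ck_on k A (fun y : 'rV[R]_n => y 0 j).
Proof.
case: k => [|k]; first by split=> // x _; exact: coord_continuous.
apply: (@Ck_on_intro _ _ (fun i _ => (i == j)%:R)) => [x _|i x _|i].
- exact: coord_continuous.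
- exact: partial_coord.
- exact: Ck_on_cst.
Qed.

(* Ck_on only controls the derivatives along the coordinate axes. *)
Lemma Ck_on_is_derive k u x v : Ck_on k.+1 A u -> A x ->
  is_derive x v u (\sum_i v 0 i * partial i u x).
Proof.
move=> uk Ax.
suff H (c : 'I_n -> R) : is_derive x (\sum_i c i *: delta_mx 0 i) u
    (\sum_i c i * partial i u x) by have := H (v 0); rewrite -row_sum_delta.
elim: (index_enum _) => [|i r IH]; first by rewrite !big_nil; exact: is_derive0.
rewrite !big_cons addrC [X in is_derive _ _ _ X]addrC.
have dP y : A y -> is_derive y (c i *: delta_mx 0 i) u (c i * partial i u y).
  by move=> Ay; apply/is_derive_scale; exact: Ck_on_derivable uk Ay.
rewrite -(derive_val_of (dP x Ax)).
apply: is_derive_add_dir => //.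
  apply: filterS (near_open Ax) => y Ay.
  exact: (ex_derive_of (dP y Ay)).
apply: (@near_eq_continuous _ _ (fun y => c i * partial i u y)).
  apply: filterS (near_open Ax) => y Ay.
  by rewrite (derive_val_of (dP y Ay)).
apply: (@continuousM _ _ (fun=> c i) (partial i u)); first exact: cst_continuous.
exact: (Ck_on_continuous (Ck_on_partial i uk) Ax).
Qed.

Lemma partialC k u x (i j : 'I_n) : Ck_on k.+2 A u -> A x ->
  partial i (partial j u) x = partial j (partial i u) x.
Proof.
move=> uk Ax.
apply: derive_comm.
- by apply: filterS (near_open Ax) => y; exact: Ck_on_derivable uk.
- by apply: filterS (near_open Ax) => y; exact: Ck_on_derivable uk.
- by apply: filterS (near_open Ax) => y; exact: (Ck_on_derivable (Ck_on_partial _ uk)).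
- by apply: filterS (near_open Ax) => y; exact: (Ck_on_derivable (Ck_on_partial _ uk)).
- exact: (Ck_on_continuous (Ck_on_partial _ (Ck_on_partial _ uk)) Ax).
- exact: (Ck_on_continuous (Ck_on_partial _ (Ck_on_partial _ uk)) Ax).
Qed.

Lemma partial_local_max k u x i : Ck_on k.+1 A u -> A x ->
  (\forall y \near x, u y <= u x) -> partial i u x = 0.
Proof.
move=> uk Ax ux; apply: derive_local_max => //.
by apply: filterS (near_open Ax) => y; exact: Ck_on_derivable uk.
Qed.

Lemma hessian_local_max k u x v : Ck_on k.+2 A u -> A x ->
  (\forall y \near x, u y <= u x) ->
  \sum_i \sum_j v 0 i * v 0 j * partial i (partial j u) x <= 0.
Proof.
move=> uk Ax ux.
have D1 y : A y -> 'D_v u y = \sum_j v 0 j * partial j u y.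
  by move=> Ay; exact: (derive_val_of (Ck_on_is_derive v uk Ay)).
have N : \forall y \near x, \sum_j v 0 j * partial j u y = 'D_v u y.
  by apply: filterS (near_open Ax) => y /D1.
have C1 : Ck_on k.+1 A (fun y => \sum_j v 0 j * partial j u y).
  apply: Ck_on_sum => j; apply: Ck_on_mul; first exact: Ck_on_cst.
  exact: Ck_on_partial.
have D2 := near_eq_is_derive N (Ck_on_is_derive v C1 Ax).
have := @derive2_local_max _ _ u x v ux.
rewrite (derive_val_of D2) => H.
suff <- : \sum_i v 0 i * partial i (fun y => \sum_j v 0 j * partial j u y) x =
  \sum_i \sum_j v 0 i * v 0 j * partial i (partial j u) x.
  apply: H; last exact: (ex_derive_of D2).
  apply: filterS (near_open Ax) => y Ay.
  exact: (ex_derive_of (Ck_on_is_derive v uk Ay)).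
apply: eq_bigr => i _; under eq_bigr do rewrite -mulrA.
rewrite -mulr_sumr; congr (_ * _).
rewrite /partial.
have -> : (fun y => \sum_j v 0 j * 'D_(delta_mx 0 j) u y) =
   \sum_j (fun y => v 0 j * partial j u y).
  by apply/funext => y; rewrite fct_sumE.
rewrite derive_sum => [|j].
  apply: eq_bigr => j _; rewrite deriveMl//.
  exact: (Ck_on_derivable (Ck_on_partial _ uk)).
apply: (@derivableM _ _ (cst (v 0 j)) (partial j u)); first exact: derivable_cst.
exact: (Ck_on_derivable (Ck_on_partial _ uk)).
Qed.

End Ck_closure.

(** * Positive definite matrices *)

Lemma bilinear_formE (R : comNzRingType) n (A : 'M[R]_n) (v w : 'rV[R]_n) :
  (v *m A *m w^T) 0 0 = \sum_k \sum_l A k l * (v 0 k * w 0 l).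
Proof.
rewrite mxE exchange_big/=; apply: eq_bigr => l _; rewrite !mxE mulr_suml.
by apply: eq_bigr => k _; rewrite mulrCA mulrA.
Qed.

Section posdef.
Variable R : rcfType.

Definition posdef n (A : 'M[R]_n) :=
  forall v : 'rV[R]_n, v != 0 -> 0 < (v *m A *m v^T) 0 0.

Lemma posdef_unit n (A : 'M[R]_n) : posdef A -> A \in unitmx.
Proof.
move=> pA; rewrite -row_free_unit -kermx_eq0; apply/eqP/row_matrixP => i.
rewrite row0; apply/eqP; apply: contraT => /pA; rewrite -row_mul mulmx_ker.
by rewrite row0 mul0mx mxE ltxx.
Qed.

Lemma posdef_inv n (A : 'M[R]_n) : A^T = A -> posdef A -> posdef (invmx A).
Proof.
move=> sA pA v v0; have uA := posdef_unit pA.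
have -> : v *m invmx A *m v^T = (v *m invmx A) *m A *m (v *m invmx A)^T.
  by rewrite mulmxKV// trmx_mul trmx_inv sA mulmxA.
by apply: pA; apply: contra v0 => /eqP E; rewrite -[v](mulmxKV uA) E mul0mx.
Qed.

Lemma posdef_factor n (A : 'M[R]_n) : A^T = A -> posdef A ->
  exists B : 'M[R]_n, A = B^T *m B.
Proof.
elim: n A => [|n IH] A sA pA; first by exists 0; apply/matrixP => -[].
rewrite -[n.+1]/(1 + n)%N in A sA pA *.
set a := ulsubmx A 0 0; set b := ursubmx A; set D := drsubmx A.
have EA : A = block_mx a%:M b b^T D.
  rewrite -[LHS]submxK /D /b trmx_ursub sA; congr block_mx.
  exact: mx11_scalar.
have sD : D^T = D by rewrite /D trmx_drsub sA.
have a0 : 0 < a.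
  have := pA (row_mx 1%:M 0); rewrite EA tr_row_mx mul_row_block mul_row_col.
  rewrite !mul1mx !mul0mx !addr0 trmx1 mulmx1 trmx0 mulmx0 addr0 mxE eqxx mulr1n.
  apply; apply/eqP => /(congr1 (fun M : 'rV_(1 + n) => lsubmx M 0 0)).
  by rewrite row_mxKl /lsubmx !mxE eqxx => /eqP; rewrite oner_eq0.
pose S := D - a^-1 *: (b^T *m b).
have [|w w0|B EB] := IH S.
- by rewrite /S linearB/= linearZ/= trmx_mul trmxK sD.
- have := pA (row_mx (- a^-1 *: (w *m b^T)) w).
  rewrite EA tr_row_mx mul_row_block mul_row_col mul_mx_scalar scalerA mulrN.
  rewrite mulfV ?gt_eqF// scaleN1r addNr mul0mx add0r.
  rewrite (_ : _ + _ = w *m S) => [|].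
    apply; apply: contra w0 => /eqP/(congr1 rsubmx).
    by rewrite row_mxKr linear0 => ->.
  by rewrite /S mulmxBr -scalemxAr mulmxA -scalemxAl scaleNr addrC.
pose s := Num.sqrt a.
have s2 : s * s = a by rewrite -expr2 sqr_sqrtr// ltW.
have s0 : s != 0 by rewrite gt_eqF// sqrtr_gt0.
exists (block_mx s%:M (s^-1 *: b) 0 B).
rewrite tr_block_mx mulmx_block tr_scalar_mx trmx0 !mulmx0 !mul0mx !addr0.
rewrite -EB EA -scalar_mxM s2 mul_scalar_mx scalerA mulfV// scale1r.
rewrite linearZ/= mul_mx_scalar scalerA mulfV// scale1r.
rewrite -scalemxAl -scalemxAr scalerA -invfM s2 /S.
by congr block_mx; rewrite addrC subrK.
Qed.

Lemma posdef_det_gt0 n (A : 'M[R]_n) : A^T = A -> posdef A -> 0 < \det A.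
Proof.
move=> sA pA; have := posdef_unit pA; rewrite unitmxE unitfE.
have [B ->] := posdef_factor sA pA; rewrite det_mulmx det_tr -expr2 => d0.
by rewrite lt_neqAle eq_sym d0 sqr_ge0.
Qed.

Lemma posdef_contract_le0 n (A H : 'M[R]_n) : A^T = A -> posdef A ->
  (forall v : 'rV[R]_n, \sum_i \sum_j v 0 i * v 0 j * H i j <= 0) ->
  \sum_i \sum_j A i j * H i j <= 0.
Proof.
move=> sA pA nH; have [B ->] := posdef_factor sA pA.
have -> : \sum_i \sum_j (B^T *m B) i j * H i j =
    \sum_k \sum_i \sum_j B k i * B k j * H i j.
  rewrite [RHS]exchange_big/=; apply: eq_bigr => i _; rewrite [RHS]exchange_big/=.
  apply: eq_bigr => j _; rewrite mxE mulr_suml.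
  by apply: eq_bigr => k _; rewrite mxE.
apply: sumr_le0 => k _; have := nH (row k B).
by under eq_bigr do under eq_bigr do rewrite !mxE.
Qed.

End posdef.

Lemma mxtrace_sqr0 (F : fieldType) n (N : 'M[F]_n) : N *m N = 0 -> \tr N = 0.
Proof.
move=> N2; have := mulmx_base N; have := col_base_full N; have := row_base_free N.
move: (col_base N) (row_base N) => C B fB fC E; rewrite -E mxtrace_mulC.
suff -> : B *m C = 0 by rewrite mxtrace0.
apply: (row_free_inj fB); apply: (row_full_inj fC).
by rewrite mul0mx mulmx0 -!mulmxA mulmxA E.
Qed.

Section smooth_matrix.
Variables (R : realType) (m : nat) (A : set 'rV[R]_m).
Hypothesis Aopen : open A.

Lemma Ck_on_det k n (M : 'rV[R]_m -> 'M[R]_n) :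
  (forall i j, Ck_on k A (fun x => M x i j)) -> Ck_on k A (fun x => \det (M x)).
Proof.
move=> Mk; apply: Ck_on_sum => // s; apply: Ck_on_mul => //.
  exact: Ck_on_cst.
exact: Ck_on_prod.
Qed.

Lemma Ck_on_invmx k n (M : 'rV[R]_m -> 'M[R]_n) :
  (forall x, A x -> M x \in unitmx) ->
  (forall i j, Ck_on k A (fun x => M x i j)) ->
  forall i j, Ck_on k A (fun x => invmx (M x) i j).
Proof.
move=> Mu Mk i j.
apply: (@Ck_on_ext _ _ _ Aopen _ (fun x => (\det (M x))^-1 * cofactor (M x) j i)).
  by move=> x; rewrite inE => Ax; rewrite /invmx Mu// !mxE.
apply: Ck_on_mul => //.
  apply: Ck_on_inv => //; last exact: Ck_on_det.
  by move=> x /Mu; rewrite unitmxE unitfE.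
apply: Ck_on_mul => //; first exact: Ck_on_cst.
apply: Ck_on_det => i' j'.
under eq_fun do rewrite !mxE.
exact: Mk.
Qed.

End smooth_matrix.

(** * The Laplacian in a chart *)

Section chart_calculus.
Variables (R : realType) (n : nat) (M : smooth_manifold R n).
Variables (g : riemannian_metric M) (c : chart R n M).
Hypothesis atlas_c : atlas c.
Implicit Types (u w : 'rV[R]_n -> R) (x : 'rV[R]_n).
Local Notation A := (chart_img c).

Lemma chart_img_is_open : open A.
Proof. exact: chart_img_open. Qed.

Let Aopen := chart_img_is_open.

Definition gram_inv x : 'M[R]_n := invmx (g c x).

Lemma metric_posdef x : A x -> posdef (g c x).
Proof. by move=> Ax v v0; exact: Defs.metric_pos. Qed.

Lemma metric_unit x : A x -> g c x \in unitmx.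
Proof. by move/metric_posdef/posdef_unit. Qed.

Lemma gram_inv_sym x : A x -> (gram_inv x)^T = gram_inv x.
Proof. by move=> Ax; rewrite trmx_inv Defs.metric_sym. Qed.

Lemma gram_inv_posdef x : A x -> posdef (gram_inv x).
Proof. by move=> Ax; apply: posdef_inv; [exact: Defs.metric_sym|exact: metric_posdef]. Qed.

Lemma gram_inv_Ck k i j : Ck_on k A (fun x => gram_inv x i j).
Proof.
apply: Ck_on_invmx => //; first exact: metric_unit.
by move=> a b; exact: Defs.metric_smooth.
Qed.

Lemma volume_density_gt0 x : A x -> 0 < volume_density g c x.
Proof.
move=> Ax; rewrite sqrtr_gt0 posdef_det_gt0//; first exact: Defs.metric_sym.
exact: metric_posdef.
Qed.

Lemma volume_density_Ck k : Ck_on k A (volume_density g c).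
Proof.
apply: Ck_on_sqrt => // [x Ax|].
  by rewrite posdef_det_gt0//; [exact: Defs.metric_sym|exact: metric_posdef].
by apply: Ck_on_det => // i j; exact: Defs.metric_smooth.
Qed.

Definition weighted_gram_inv l k x : R := volume_density g c x * gram_inv x l k.

Lemma weighted_gram_inv_Ck j l k : Ck_on j A (weighted_gram_inv l k).
Proof. by apply: Ck_on_mul => //; [exact: volume_density_Ck|exact: gram_inv_Ck]. Qed.

Lemma laplacianE u x j : Ck_on j.+2 A u -> A x ->
  laplacian g c u x = (volume_density g c x)^-1 *
    \sum_k \sum_l (weighted_gram_inv l k x * partial k (partial l u) x
                 + partial l u x * partial k (weighted_gram_inv l k) x).
Proof.
move=> uk Ax; rewrite /laplacian /divergence; congr (_ * _).
apply: eq_bigr => k _.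
have -> : (fun y => volume_density g c y * grad g c u y 0 k) =
    \sum_l (weighted_gram_inv l k * partial l u).
  apply/funext => y; rewrite fct_sumE mxE mulr_sumr; apply: eq_bigr => l _.
  by rewrite /weighted_gram_inv !mxE mulrCA mulrC.
have d1 l : derivable (weighted_gram_inv l k) x (delta_mx 0 k).
  exact: (Ck_on_derivable (weighted_gram_inv_Ck 1 l k) Ax).
have d2 l : derivable (partial l u) x (delta_mx 0 k).
  exact: (Ck_on_derivable (Ck_on_partial l uk) Ax).
rewrite {1}/partial derive_sum => [|l]; last exact: (derivableM (d1 l) (d2 l)).
by apply: eq_bigr => l _; rewrite (deriveM (d1 l) (d2 l)).
Qed.

Lemma laplacian_Ck j u : Ck_on j.+2 A u -> Ck_on j A (laplacian g c u).
Proof.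
move=> uk.
pose F x := (volume_density g c x)^-1 *
    \sum_k \sum_l (weighted_gram_inv l k x * partial k (partial l u) x
                 + partial l u x * partial k (weighted_gram_inv l k) x).
apply: (@Ck_on_ext _ _ _ Aopen _ F).
  by move=> x; rewrite inE => Ax; rewrite (laplacianE uk).
apply: Ck_on_mul => //.
  apply: Ck_on_inv => //; last exact: volume_density_Ck.
  by move=> x Ax; rewrite gt_eqF// volume_density_gt0.
apply: Ck_on_sum => // k; apply: Ck_on_sum => // l; apply: Ck_on_add => //.
  apply: Ck_on_mul => //; first exact: weighted_gram_inv_Ck.
  exact/Ck_on_partial/Ck_on_partial.
apply: Ck_on_mul => //; first exact/Ck_onW/Ck_on_partial.
exact/Ck_on_partial/weighted_gram_inv_Ck.
Qed.

Lemma partial_add u w x k : derivable u x (delta_mx 0 k) ->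
  derivable w x (delta_mx 0 k) ->
  partial k (fun y => u y + w y) x = partial k u x + partial k w x.
Proof. exact: deriveD. Qed.

Lemma partial_scale (a : R) u x k : derivable u x (delta_mx 0 k) ->
  partial k (fun y => a * u y) x = a * partial k u x.
Proof. by move=> du; rewrite /partial -deriveMl. Qed.

Lemma partial_mul u w x k : derivable u x (delta_mx 0 k) ->
  derivable w x (delta_mx 0 k) ->
  partial k (fun y => u y * w y) x = u x * partial k w x + w x * partial k u x.
Proof. exact: deriveM. Qed.

Lemma partial_ext u w x k : A x -> {in A, u =1 w} ->
  partial k u x = partial k w x.
Proof.
move=> Ax uw; apply: near_eq_derive.
by apply: filterS (near_open Aopen Ax) => y Ay; rewrite uw ?inE.
Qed.

Lemma partial2_add_scale (a : R) j u w x k l : A x -> Ck_on j.+2 A u ->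
  Ck_on j.+2 A w ->
  partial k (partial l (fun y => u y + a * w y)) x =
  partial k (partial l u) x + a * partial k (partial l w) x.
Proof.
move=> Ax uk wk.
have dw y i : A y -> derivable w y (delta_mx 0 i).
  by move=> Ay; exact: Ck_on_derivable wk Ay.
have daw y i : A y -> derivable (fun y => a * w y) y (delta_mx 0 i).
  by move=> Ay; apply: (@derivableM _ _ (cst a) w) => //; exact: dw.
have E : {in A, partial l (fun y => u y + a * w y) =1
     (fun y => partial l u y + a * partial l w y)}.
  move=> y; rewrite inE => Ay.
  rewrite partial_add; [|exact: Ck_on_derivable uk Ay|exact: daw].
  by rewrite partial_scale//; exact: dw.
rewrite (partial_ext _ Ax E).
have dlw : derivable (partial l w) x (delta_mx 0 k).
  exact: Ck_on_derivable (Ck_on_partial _ wk) Ax.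
rewrite partial_add; first by rewrite partial_scale.
- exact: Ck_on_derivable (Ck_on_partial _ uk) Ax.
- exact: (derivableM (derivable_cst a x _) dlw).
Qed.

Lemma laplacian_add_scale (a : R) j u w x : A x -> Ck_on j.+2 A u ->
  Ck_on j.+2 A w ->
  laplacian g c (fun y => u y + a * w y) x =
  laplacian g c u x + a * laplacian g c w x.
Proof.
move=> Ax uk wk.
have uwk : Ck_on j.+2 A (fun y => u y + a * w y).
  exact: (Ck_on_add Aopen uk (Ck_on_mul Aopen (Ck_on_cst Aopen _ a) wk)).
rewrite (laplacianE uk)// (laplacianE wk)// (laplacianE uwk)//.
rewrite mulrCA -mulrDr; congr (_ * _).
rewrite mulr_sumr -big_split/=; apply: eq_bigr => k _.
rewrite mulr_sumr -big_split/=; apply: eq_bigr => l _.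
rewrite (partial2_add_scale _ _ _ Ax uk wk).
rewrite partial_add; last 2 first.
- exact: Ck_on_derivable uk Ax.
- by apply: (@derivableM _ _ (cst a) w) => //; exact: Ck_on_derivable wk Ax.
rewrite partial_scale; last exact: Ck_on_derivable wk Ax.
have E (p q a1 a2 b1 b2 : R) : p * (a1 + a * a2) + (b1 + a * b2) * q =
  p * a1 + b1 * q + a * (p * a2 + b2 * q) by ring.
exact: E.
Qed.

Lemma laplacian_critical j u x : A x -> Ck_on j.+2 A u ->
  (forall k, partial k u x = 0) ->
  laplacian g c u x =
  \sum_k \sum_l gram_inv x k l * partial k (partial l u) x.
Proof.
move=> Ax uk u0; rewrite (laplacianE uk)// mulr_sumr; apply: eq_bigr => k _.
rewrite mulr_sumr; apply: eq_bigr => l _.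
rewrite u0 mul0r addr0 /weighted_gram_inv !mulrA mulVf ?mul1r; last first.
  by rewrite gt_eqF// volume_density_gt0.
by rewrite -{1}(gram_inv_sym Ax) mxE.
Qed.

Lemma laplacian_local_max j u x : A x -> Ck_on j.+2 A u ->
  (\forall y \near x, u y <= u x) -> laplacian g c u x <= 0.
Proof.
move=> Ax uk ux; rewrite (laplacian_critical Ax uk) => [|k]; last first.
  exact: partial_local_max uk Ax ux.
pose H : 'M[R]_n := \matrix_(k, l) partial k (partial l u) x.
have nH (v : 'rV[R]_n) : \sum_i \sum_j v 0 i * v 0 j * H i j <= 0.
  under eq_bigr do under eq_bigr do rewrite mxE.
  exact: hessian_local_max uk Ax ux.
have := posdef_contract_le0 (gram_inv_sym Ax) (gram_inv_posdef Ax) nH.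
by under eq_bigr do under eq_bigr do rewrite [H _ _]mxE.
Qed.

Lemma partial2_sqr j u x k l : A x -> Ck_on j.+2 A u -> u x = 0 ->
  partial k (partial l (fun y => u y * u y)) x =
  2 * (partial k u x * partial l u x).
Proof.
move=> Ax uk u0.
have du y i : A y -> derivable u y (delta_mx 0 i).
  by move=> Ay; exact: Ck_on_derivable uk Ay.
have E : {in A, partial l (fun y => u y * u y) =1
     (fun y => 2 * (u y * partial l u y))}.
  move=> y; rewrite inE => Ay.
  by rewrite partial_mul; [rewrite -mulr2n mulr_natl|exact: du|exact: du].
have dlu : derivable (partial l u) x (delta_mx 0 k).
  exact: Ck_on_derivable (Ck_on_partial _ uk) Ax.
rewrite (partial_ext _ Ax E) partial_scale; last first.
  exact: (derivableM (du x k Ax) dlu).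
rewrite (partial_mul (du x k Ax) dlu).
by rewrite u0 mul0r add0r [X in 2 * X]mulrC.
Qed.

Lemma laplacian_sqr j u x : A x -> Ck_on j.+2 A u -> u x = 0 ->
  laplacian g c (fun y => u y * u y) x =
  2 * \sum_k \sum_l gram_inv x k l * (partial k u x * partial l u x).
Proof.
move=> Ax uk u0.
have du i : derivable u x (delta_mx 0 i) by exact: Ck_on_derivable uk Ax.
have uuk : Ck_on j.+2 A (fun y => u y * u y) by exact: (Ck_on_mul Aopen uk uk).
rewrite (laplacian_critical Ax uuk) => [|k]; last first.
  by rewrite partial_mul// u0 !mul0r addr0.
rewrite mulr_sumr; apply: eq_bigr => k _; rewrite mulr_sumr.
apply: eq_bigr => l _; by rewrite (partial2_sqr _ _ Ax uk u0) mulrCA.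
Qed.

End chart_calculus.

(** * Charts and connected components *)

Section charts.
Variables (R : realType) (n : nat) (M : smooth_manifold R n).

Lemma chart_ball (q : M) (P : M -> Prop) : (\forall p \near q, P p) ->
  exists c : chart R n M, exists2 r : R, atlas c /\ chart_dom c q & 0 < r /\
    forall x, `|c q - x| < r -> chart_img c x /\ P (chart_inv c x).
Proof.
move=> Pq; have [c ac cq] := atlas_cover q; exists c.
have Aq : chart_img c (c q) by exists q.
have : \forall x \near c q, chart_img c x /\ P (chart_inv c x).
  have H1 : \forall x \near c q, chart_img c x.
    by apply: near_open => //; exact: chart_img_open.
  have H2 : \forall x \near c q, P (chart_inv c x).
    have := chart_inv_continuous Aq.
    by rewrite /prop_for /continuous_at chart_mapK//; apply.
  by apply: filterS2 H1 H2.
by move=> /nbhs_normP[r /= r0 rP]; exists r; split => // x; exact: rP.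
Qed.

Lemma chart_nbhs (c : chart R n M) (q : M) (P : M -> Prop) : chart_dom c q ->
  (\forall x \near c q, P (chart_inv c x)) -> \forall p \near q, P p.
Proof.
move=> cq Pq.
have H1 : \forall p \near q, chart_dom c p.
  by apply: open_nbhs_nbhs; split => //; exact: chart_dom_open.
have H2 : \forall p \near q, P (chart_inv c (c p)).
  by move: Pq; have := chart_map_continuous cq; rewrite /prop_for /continuous_at; apply.
apply: filterS2 H1 H2 => p cp; rewrite chart_mapK//.
Qed.

Lemma chart_near (c : chart R n M) (q : M) (P : M -> Prop) : chart_dom c q ->
  (\forall p \near q, P p) -> \forall x \near c q, P (chart_inv c x).
Proof.
move=> cq Pq; have Aq : chart_img c (c q) by exists q.
by have := chart_inv_continuous Aq; rewrite /prop_for /continuous_at chart_mapK//; apply.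
Qed.

Lemma near_connected (q : M) (O : set M) : (\forall p \near q, O p) ->
  exists2 W : set M, (\forall p \near q, W p) &
    [/\ W q, W `<=` O & connected W].
Proof.
move=> /chart_ball[c [r [ac cq] [r0 rO]]].
pose W := chart_inv c @` [set x | `|c q - x| < r].
have Wq : W q by exists (c q); rewrite /= ?subrr ?normr0// chart_mapK.
exists W; first apply: (@chart_nbhs c) => //.
  by apply/nbhs_normP; exists r => //= x; exists x.
split=> // [_ [x /= xr <-]|]; first by have [] := rO x xr.
pose s x := (fun t : R => chart_inv c (c q + t *: (x - c q))) @` `[0, 1].
have sr x (t : R) : `|c q - x| < r -> 0 <= t <= 1 ->
    `|c q - (c q + t *: (x - c q))| < r.
  move=> xr /andP[t0 t1]; rewrite opprD addNKr normrN normrZ ger0_norm// distrC.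
  by rewrite (le_lt_trans _ xr)// ler_piMl.
have -> : W = \bigcup_(x in [set x | `|c q - x| < r]) s x.
  apply/seteqP; split=> [_ [x /= xr <-]|p [x /= xr [t t01 <-]]].
    exists x => //; exists 1; first by rewrite /= in_itv/= ler01 lexx.
    by rewrite scale1r addrC subrK.
  move: t01; rewrite /= in_itv/= => t01; exists (c q + t *: (x - c q)) => //.
  exact: sr.
apply: bigcup_connected => [|x /= xr].
  exists q => x /= xr; exists 0; first by rewrite /= in_itv/= lexx ler01.
  by rewrite scale0r addr0 chart_mapK.
apply: connected_continuous_connected; first exact: segment_connected.
apply: continuous_in_subspaceT => t; rewrite inE/= in_itv/= => t01.
apply: (@continuous_comp _ _ _ (fun t : R => c q + t *: (x - c q)) (chart_inv c)).
  apply: continuousD; first exact: cst_continuous.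
  exact: scalel_continuous.
by apply: chart_inv_continuous; have [] := rO _ (sr x t xr t01).
Qed.

Lemma component_near (O : set M) (x q : M) : open O ->
  connected_component O x q -> \forall p \near q, connected_component O x p.
Proof.
move=> oO Cq; have Oq : O q := connected_component_sub Cq.
have [W nW [Wq WO cW]] : exists2 W : set M, (\forall p \near q, W p) &
    [/\ W q, W `<=` O & connected W].
  exact/near_connected/open_nbhs_nbhs.
apply: filterS nW => p Wp; apply: connected_component_trans Cq _.
exact: (connected_component_max Wq WO cW).
Qed.

Lemma component_closure (O : set M) (x q : M) : open O -> O q ->
  closure (connected_component O x) q -> connected_component O x q.
Proof.
move=> oO Oq cl.
have [W nW [Wq WO cW]] : exists2 W : set M, (\forall p \near q, W p) &
    [/\ W q, W `<=` O & connected W].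
  exact/near_connected/open_nbhs_nbhs.
have [p [Cp Wp]] := cl W nW.
apply: connected_component_trans Cp _; apply: connected_component_sym.
exact: (connected_component_max Wq WO cW).
Qed.

End charts.

(** * The strong maximum principle *)

Section euclidean_distance.
Variables (R : realType) (n : nat).
Implicit Types x y v : 'rV[R]_n.

Definition sqnorm v : R := \sum_k v 0 k ^+ 2.

Lemma sqnorm_ge0 v : 0 <= sqnorm v.
Proof. by apply: sumr_ge0 => k _; exact: sqr_ge0. Qed.

Lemma sqnorm0 : sqnorm 0 = 0.
Proof. by rewrite /sqnorm big1// => k _; rewrite mxE expr0n. Qed.

Lemma sqnormN v : sqnorm (- v) = sqnorm v.
Proof. by apply: eq_bigr => k _; rewrite mxE sqrrN. Qed.

Lemma sqnorm_eq0 v : sqnorm v = 0 -> v = 0.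
Proof.
move=> /eqP; rewrite psumr_eq0 => [/allP h|k _]; last exact: sqr_ge0.
apply/rowP => k; rewrite mxE; apply/eqP; rewrite -sqrf_eq0.
exact: h (mem_index_enum k).
Qed.

Lemma sqnorm_gt0 v : v != 0 -> 0 < sqnorm v.
Proof.
move=> v0; rewrite lt_neqAle sqnorm_ge0 andbT eq_sym.
by apply: contra v0 => /eqP/sqnorm_eq0 ->.
Qed.

Lemma norm_lt_sqnorm v (r : R) : 0 < r -> sqnorm v < r ^+ 2 -> `|v| < r.
Proof.
move=> r0 vr; rewrite [ltLHS]/Num.Def.normr/= mx_normrE.
apply/bigmax_ltP; split=> // -[i k] _ /=; rewrite ord1.
rewrite -(ltr_pXn2r (_ : (0 < 2)%N)) ?nnegrE ?(ltW r0)//.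
rewrite -normrX ger0_norm ?sqr_ge0//; apply: le_lt_trans vr.
rewrite /sqnorm (bigD1 k)//= lerDl; apply: sumr_ge0 => l _; exact: sqr_ge0.
Qed.

Lemma sqnorm_Ck k (A : set 'rV[R]_n) x0 : open A ->
  Ck_on k A (fun y => sqnorm (y - x0)).
Proof.
move=> oA; apply: Ck_on_sum => // i; under eq_fun do rewrite expr2 !mxE.
have h : Ck_on k A (fun y : 'rV[R]_n => y 0 i - x0 0 i).
  by apply: Ck_on_add => //; [exact: Ck_on_coord|exact: Ck_on_cst].
exact: (Ck_on_mul oA h h).
Qed.

Lemma sqnorm_continuous x0 : continuous (fun y => sqnorm (y - x0)).
Proof.
move=> x; exact: (Ck_on_continuous (@sqnorm_Ck 0 setT x0 openT)).
Qed.

Lemma partial_sqnorm x0 x (k : 'I_n) :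
  partial k (fun y => sqnorm (y - x0)) x = 2 * (x 0 k - x0 0 k).
Proof.
pose F (i : 'I_n) (y : 'rV[R]_n) := (y 0 i - x0 0 i) * (y 0 i - x0 0 i).
have dF i : is_derive x (delta_mx 0 k) (F i) (2 * (x 0 i - x0 0 i) * (k == i)%:R).
  have d1 : is_derive x (delta_mx 0 k) (fun y : 'rV[R]_n => y 0 i - x0 0 i) (k == i)%:R.
    have := is_deriveD (partial_coord k i x) (is_derive_cst (- x0 0 i) x (delta_mx 0 k)).
    by rewrite addr0.
  apply: (is_derive_eq (is_deriveM d1 d1)).
  by rewrite -mulrA mulr_natl mulr2n.
have -> : (fun y => sqnorm (y - x0)) = \sum_i F i.
  apply/funext => y; rewrite fct_sumE; apply: eq_bigr => i _.
  by rewrite !mxE expr2.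
rewrite /partial derive_sum => [|i]; last exact: (ex_derive_of (dF i)).
rewrite (bigD1 k)//= big1 => [|i ik].
  by rewrite (derive_val_of (dF k)) eqxx mulr1 addr0.
by rewrite (derive_val_of (dF i)) eq_sym (negbTE ik) mulr0.
Qed.

Lemma norm_sub_continuous x0 : continuous (fun y : 'rV[R]_n => `|y - x0|).
Proof.
move=> y.
have c1 : {for y, continuous (fun y : 'rV[R]_n => y - x0)}.
  by apply: continuousB; [exact: cvg_id|exact: cst_continuous].
have c2 : {for y - x0, continuous (Num.norm : 'rV[R]_n -> R)}.
  exact: norm_continuous.
exact: (continuous_comp c1 c2).
Qed.

Lemma closed_ball_norm_compact x0 (r : R) : compact [set y : 'rV[R]_n | `|y - x0| <= r].
Proof.
apply: bounded_closed_compact.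
  exists (`|x0| + r); split; first exact: num_real.
  move=> m mr y /= yr; apply: le_trans (ltW mr).
  by rewrite -[y](subrK x0) addrC (le_trans (ler_normD _ _))// lerD2l.
have -> : [set y : 'rV[R]_n | `|y - x0| <= r] = (fun y => `|y - x0|) @^-1` [set t | t <= r] by [].
apply: closed_comp; last exact: closed_le.
by move=> y _; exact: norm_sub_continuous.
Qed.

End euclidean_distance.

Section hopf.
Variables (R : realType) (n : nat) (M : smooth_manifold R n).
Variables (g : riemannian_metric M) (c : chart R n M).
Hypothesis atlas_c : atlas c.
Local Notation A := (chart_img c).

(* The barrier h = s + a s^2 vanishes at y0, is negative wherever s < 0, and
   satisfies L h > 0 near y0 when a is large, because ds != 0 at y0; adding a
   small multiple of h to u creates an interior maximum with positive Laplacian. *)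
Lemma hopf_touching (u : 'rV[R]_n -> R) (x0 y0 : 'rV[R]_n) : Ck_on 2 A u ->
  (forall x, A x -> laplacian g c u x = 0) -> A y0 -> x0 != y0 ->
  (\forall y \near y0, u y <= u y0) ->
  (\forall y \near y0, sqnorm (y - x0) < sqnorm (y0 - x0) -> u y < u y0) ->
  False.
Proof.
move=> u2 Lu Ay0 xy umax utouch.
have oA : open A := @chart_img_open _ _ _ c.
pose s y := sqnorm (y0 - x0) + (- sqnorm (y - x0)) + (- sqnorm (y - y0)).
have sk (k : nat) (B : set 'rV[R]_n) : open B -> Ck_on k B s.
  move=> oB; apply: Ck_on_add => //; last first.
    by apply: Ck_on_opp => //; exact: sqnorm_Ck.
  apply: Ck_on_add => //; first exact: Ck_on_cst.
  by apply: Ck_on_opp => //; exact: sqnorm_Ck.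
have s_cont : continuous s.
  by move=> x; exact: (Ck_on_continuous (sk 0 setT openT)).
have s0 : s y0 = 0 by rewrite /s !subrr sqnorm0 oppr0 addr0.
have dsq z k : derivable (fun y : 'rV[R]_n => sqnorm (y - z)) y0 (delta_mx 0 k).
  exact: (Ck_on_derivable (sqnorm_Ck 1 z (@openT _)) (I : setT y0)).
have ds k : partial k s y0 = - 2 * (y0 - x0) 0 k.
  have d1 : derivable (fun y : 'rV[R]_n => - sqnorm (y - x0)) y0 (delta_mx 0 k).
    exact: derivableN (dsq x0 k).
  have d2 : derivable (fun y : 'rV[R]_n => - sqnorm (y - y0)) y0 (delta_mx 0 k).
    exact: derivableN (dsq y0 k).
  have d3 : derivable (fun y : 'rV[R]_n => sqnorm (y0 - x0)) y0 (delta_mx 0 k).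
    exact: derivable_cst.
  rewrite /s (partial_add (derivableD d3 d1) d2).
  rewrite (partial_add d3 d1) {1}/partial derive_cst add0r.
  have -> : partial k (fun y => - sqnorm (y - x0)) y0 = - partial k (fun y => sqnorm (y - x0)) y0.
    exact: deriveN (dsq x0 k).
  have -> : partial k (fun y => - sqnorm (y - y0)) y0 = - partial k (fun y => sqnorm (y - y0)) y0.
    exact: deriveN (dsq y0 k).
  by rewrite !partial_sqnorm subrr mulr0 oppr0 addr0 !mxE mulNr.
pose v : 'rV[R]_n := \row_k partial k s y0.
pose Q : R := \sum_k \sum_l gram_inv g c y0 k l * (partial k s y0 * partial l s y0).
have Q0 : 0 < Q.
  have -> : Q = (v *m gram_inv g c y0 *m v^T) 0 0.
    by rewrite bilinear_formE; apply: eq_bigr => k _; apply: eq_bigr => l _; rewrite !mxE.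
  apply: gram_inv_posdef => //; apply: contra xy => /eqP/rowP v0.
  rewrite -subr_eq0; apply/eqP/rowP => k; rewrite mxE.
  have := v0 k; rewrite !mxE ds !mxE => /eqP.
  by rewrite mulf_eq0 oppr_eq0 pnatr_eq0/= subr_eq0 => /eqP ->; rewrite subrr.
pose a : R := (`|laplacian g c s y0| + 1) / (2 * Q).
have a0 : 0 < a by rewrite divr_gt0// ?ltr_wpDl// mulr_gt0.
have s2 := sk 2%N A oA.
have ss2 : Ck_on 2 A (fun y => s y * s y) := Ck_on_mul oA s2 s2.
pose h y := s y + a * (s y * s y).
have h2 : Ck_on 2 A h := Ck_on_add oA s2 (Ck_on_mul oA (Ck_on_cst oA _ a) ss2).
have Lh0 : 0 < laplacian g c h y0.
  rewrite (laplacian_add_scale g atlas_c a Ay0 s2 ss2) (laplacian_sqr g atlas_c Ay0 s2 s0).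
  rewrite -/Q /a divfK ?gt_eqF ?mulr_gt0//.
  by have := ler_norm (- laplacian g c s y0); rewrite normrN; lra.
have nLh : \forall y \near y0, 0 < laplacian g c h y.
  have := Ck_on_continuous (laplacian_Ck g atlas_c h2) Ay0.
  by move=> /(_ _ (lt_nbhsr Lh0)) .
have ns : \forall y \near y0, 0 < 1 + a * s y.
  have c1 : {for y0, continuous (fun y => 1 + a * s y)}.
    have k1 : Ck_on 0 setT (fun y => 1 + a * s y).
      apply: Ck_on_add; [exact: openT|exact: Ck_on_cst openT _ _|].
      by apply: Ck_on_mul; [exact: openT|exact: Ck_on_cst openT _ _|exact: sk openT].
    exact: (Ck_on_continuous k1).
  have h1 : 0 < 1 + a * s y0 by rewrite s0 mulr0 addr0.
  by have := c1 _ (lt_nbhsr h1).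
have nA := near_open oA Ay0.
have : \forall y \near y0, [/\ 0 < laplacian g c h y, 0 < 1 + a * s y, A y,
    u y <= u y0 & sqnorm (y - x0) < sqnorm (y0 - x0) -> u y < u y0].
  by near=> y; split; near: y.
move=> /nbhs_normP[r0 /= r00 r0P].
pose r := r0 / 2.
have rp : 0 < r by rewrite divr_gt0.
pose K := [set y : 'rV[R]_n | `|y - y0| <= r].
have KP y : K y -> [/\ 0 < laplacian g c h y, 0 < 1 + a * s y, A y,
    u y <= u y0 & sqnorm (y - x0) < sqnorm (y0 - x0) -> u y < u y0].
  move=> Ky; apply: r0P => /=; rewrite distrC (le_lt_trans Ky)//.
  by rewrite ltr_pdivrMr// ltr_pMr// ltr1n.
have cK : compact K by exact: closed_ball_norm_compact.
have Ky0 : K y0 by rewrite /K/= subrr normr0 ltW.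
have K_cont w : Ck_on 2 A w -> {within K, continuous w}.
  move=> w2; apply: continuous_in_subspaceT => y; rewrite inE => /KP[_ _ Ay _ _].
  exact: (Ck_on_continuous w2 Ay).
pose S := [set y : 'rV[R]_n | `|y - y0| = r /\ 0 <= s y].
have SK : S `<=` K by move=> y [yr _]; rewrite /K/= yr.
have norm_cont : continuous (fun y : 'rV[R]_n => `|y - y0|).
  exact: norm_sub_continuous.
have cS : compact S.
  apply: subclosed_compact cK SK.
  have -> : S = (fun y => `|y - y0|) @^-1` [set r] `&` s @^-1` [set t | 0 <= t].
    by apply/seteqP; split=> y.
  apply: closedI; apply: closed_comp => //.
have Su y : S y -> u y < u y0.
  move=> [yr sy]; have [|_ _ _ _] := KP y; first by rewrite /K/= yr.
  apply; move: sy; rewrite /s -addrA -opprD subr_ge0; apply: lt_le_trans.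
  rewrite ltrDl sqnorm_gt0// -normr_gt0 yr//.
have [d d0 dP] : exists2 d : R, 0 < d & forall y, S y -> u y <= u y0 - d.
  have [S0|/set0P/negP] := pselect (S !=set0); last first.
    by rewrite negbK => /eqP S0; exists 1 => // y; rewrite S0.
  have Sc : {within S, continuous u}.
    apply: continuous_in_subspaceT => y; rewrite inE => /SK/KP[_ _ Ay _ _].
    exact: (Ck_on_continuous u2 Ay).
  have [z zS zmax] := compact_EVT_max S0 cS Sc.
  exists (u y0 - u z); first by rewrite subr_gt0 Su// -inE.
  by move=> y yS; rewrite subKr zmax// inE.
have [z zK zmax] := compact_EVT_max (ex_intro _ y0 Ky0) cK (K_cont h h2).
pose H := `|h z| + 1.
have H0 : 0 < H by rewrite ltr_wpDl.
have hH y : K y -> h y < H.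
  move=> Ky; apply: le_lt_trans (zmax y _) _; first by rewrite inE.
  by rewrite /H (le_lt_trans (ler_norm _))// ltrDl.
pose e := d / H.
have e0 : 0 < e by rewrite divr_gt0.
pose w y := u y + e * h y.
have w2 : Ck_on 2 A w := Ck_on_add oA u2 (Ck_on_mul oA (Ck_on_cst oA _ e) h2).
have [q qK qmax] := compact_EVT_max (ex_intro _ y0 Ky0) cK (K_cont w w2).
rewrite inE in qK.
have [Lhq sq Aq uq _] := KP q qK.
have wq : u y0 <= w q.
  have := qmax y0; rewrite inE => /(_ Ky0).
  by rewrite {1}/w /h s0 !mulr0 addr0 mulr0 addr0.
have qr : `|q - y0| < r.
  rewrite lt_neqAle qK andbT; apply/negP => /eqP qr.
  have [sq0|sq0] := leP 0 (s q).
    have uqd : u q <= u y0 - d by exact: dP.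
    have : e * h q < d by rewrite /e mulrAC ltr_pdivrMr// ltr_pM2l// hH.
    by move: wq; rewrite /w; lra.
  have : e * h q < 0.
    rewrite pmulr_rlt0// /h mulrA -[X in X + _]mul1r -mulrDl.
    by rewrite nmulr_llt0.
  by move: wq; rewrite /w; lra.
have : laplacian g c w q <= 0.
  apply: (laplacian_local_max g atlas_c Aq w2).
  have : \forall y \near q, `|y - y0| < r.
    by have := norm_cont q _ (lt_nbhsl qr).
  apply: filterS => y yr; apply: qmax; rewrite inE; exact: ltW.
rewrite (laplacian_add_scale g atlas_c e Aq u2 h2) Lu// add0r.
by rewrite leNgt mulr_gt0.
Unshelve. all: by end_near. Qed.

End hopf.

Lemma strong_maximum_local (R : realType) (n : nat) (M : smooth_manifold R n)
    (g : riemannian_metric M) (c : chart R n M) (u : 'rV[R]_n -> R) (z : 'rV[R]_n) :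
  atlas c -> Ck_on 2 (chart_img c) u ->
  (forall x, chart_img c x -> laplacian g c u x = 0) -> chart_img c z ->
  (\forall y \near z, u y <= u z) -> \forall y \near z, u y = u z.
Proof.
move=> ac u2 Lu Az uz.
have oA : open (chart_img c) := @chart_img_open _ _ _ c.
have : \forall y \near z, chart_img c y /\ u y <= u z.
  by have nA := near_open oA Az; near=> y; split; near: y.
move=> /nbhs_normP[r0 /= r00 r0P].
pose r := r0 / 2; have rp : 0 < r by rewrite divr_gt0.
have rr : r + r = r0 by rewrite -splitr.
have near_sq : \forall x \near z, sqnorm (x - z) < r ^+ 2.
  have h : sqnorm (z - z) < r ^+ 2 by rewrite subrr sqnorm0 exprn_gt0.
  by have := @sqnorm_continuous R n z z _ (lt_nbhsl h).
apply: filterS near_sq => x0 x0z.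
have zx0 : sqnorm (z - x0) < r ^+ 2 by rewrite -sqnormN opprB.
have inB y : sqnorm (y - x0) <= sqnorm (z - x0) -> `|z - y| < r0.
  move=> yz; rewrite -rr -(subrKA x0) (le_lt_trans (ler_normD _ _))// ltrD//.
    exact: norm_lt_sqnorm.
  by rewrite distrC; apply: norm_lt_sqnorm => //; exact: le_lt_trans zx0.
have [//|ux0] : u x0 = u z \/ u x0 < u z.
  have [|_] := r0P x0 (inB x0 _); first by rewrite subrr sqnorm0 sqnorm_ge0.
  by rewrite le_eqVlt => /orP[/eqP|]; [left|right].
pose K0 := [set y : 'rV[R]_n | sqnorm (y - x0) <= sqnorm (z - x0)].
pose K := [set y : 'rV[R]_n | K0 y /\ u y = u z].
have clK0 : closed K0.
  have -> : K0 = (fun y => sqnorm (y - x0)) @^-1` [set t | t <= sqnorm (z - x0)] by [].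
  apply: closed_comp; last exact: closed_le.
  by move=> y _; exact: sqnorm_continuous.
have clK : closed K.
  move=> y Ky.
  have K0y : K0 y by apply: clK0; apply: closureS Ky => t [].
  split=> //; apply: contrapT => uy.
  have [Ay _] := r0P y (inB _ K0y).
  have uc : {for y, continuous u} := Ck_on_continuous u2 Ay.
  have nuz : nbhs (u y) [set t | t <> u z].
    have : open [set t : R | t != u z] by exact: open_neq.
    move=> oz; have := open_nbhs_nbhs (conj oz (introN eqP uy)).
    by apply: filterS => t /= /eqP.
  by have [t [[_ ut] /= /(_ ut)]] := Ky _ (uc _ nuz).
have cK : compact K.
  apply: (@subclosed_compact _ _ _ clK (@closed_ball_norm_compact R n z r0)).
  by move=> y [K0y _]; rewrite /= distrC ltW// inB.
have Kz : K z by split=> //; rewrite /K0/=.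
have cd : {within K, continuous (fun y => sqnorm (y - x0))}.
  by apply: continuous_subspaceT; exact: sqnorm_continuous.
have [y yK ymin] := compact_EVT_min (ex_intro _ z Kz) cK cd.
rewrite inE in yK; have [K0y uyz] := yK.
have [Ay _] := r0P y (inB _ K0y).
have nB : \forall t \near y, `|z - t| < r0.
  have h : `|y - z| < r0 by rewrite distrC inB.
  have h' : \forall t \near y, `|t - z| < r0.
    by have := @norm_sub_continuous R n z y _ (lt_nbhsl h).
  by apply: filterS h' => t; rewrite distrC.
exfalso; apply: (@hopf_touching _ _ _ g c ac u x0 y u2 Lu Ay).
- by apply: contraTneq ux0 => ->; rewrite uyz ltxx.
- by apply: filterS nB => t /r0P[_]; rewrite uyz.
- apply: filterS nB => t /r0P[_]; rewrite uyz le_eqVlt => /orP[/eqP ut ty|//].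
  have := ymin t; rewrite leNgt ty inE => /(_ _)/negP; case=> //.
  by split=> //; apply: le_trans (ltW ty) K0y.
Unshelve. all: by end_near. Qed.

Section harmonic.
Variables (R : realType) (n : nat) (M : smooth_manifold R n).
Variable g : riemannian_metric M.
Hypothesis M_closed : closed_manifold M.

Lemma smooth_continuous (v : M -> R) : smooth v -> continuous v.
Proof.
move=> sv q; have [c ac cq] := atlas_cover q.
have Aq : chart_img c (c q) by exists q.
have h1 : {for q, continuous (v \o chart_inv c \o c)}.
  apply: continuous_comp; first exact: chart_map_continuous.
  exact: (Ck_on_continuous (sv c ac 0%N) Aq).
apply: near_eq_continuous h1.
have cdom : \forall p \near q, chart_dom c p.
  by apply: open_nbhs_nbhs; split => //; exact: chart_dom_open.
by apply: filterS cdom => p cp /=; rewrite chart_mapK.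
Qed.

Lemma harmonic_locally_constant (v : M -> R) : smooth v ->
  (forall c, atlas c -> forall x, chart_img c x ->
     laplacian g c (v \o chart_inv c) x = 0) ->
  forall x, \forall y \near x, v y = v x.
Proof.
move=> sv Lv x; have v_cont := smooth_continuous sv.
pose C := connected_component [set: M] x.
have Cx : C x by exact: connected_component_refl.
have C_near q : C q -> \forall p \near q, C p by apply: component_near; exact: openT.
have cC : compact C.
  apply: subclosed_compact M_closed _ => //.
  exact: component_closed closedT.
have [p pC pmax] := compact_EVT_max (ex_intro _ x Cx) cC (continuous_subspaceT v_cont).
rewrite inE in pC.
have loc q : C q -> v q = v p -> \forall y \near q, v y = v p.
  move=> Cq vq; have [c ac cq] := atlas_cover q.
  have Aq : chart_img c (c q) by exists q.
  apply: (chart_nbhs cq).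
  have := @strong_maximum_local _ _ _ g c (v \o chart_inv c) (c q) ac (sv c ac 2%N) (Lv c ac) Aq.
  rewrite /= chart_mapK// vq; apply.
  apply: (chart_near (P := fun y => v y <= v p)) => //.
  by apply: filterS (C_near q Cq) => y Cy; apply: pmax; rewrite inE.
pose Z := [set q | C q /\ v q = v p].
have ZC : Z = C.
  apply: (component_connected (A := [set: M]) (x := x)); first by exists p.
  - exists (Z^°); first exact: open_interior.
    apply/seteqP; split=> [q [Cq vq]|q [_ /interior_subset]//].
    split=> //; rewrite /interior/=.
    by apply: filterS2 (C_near q Cq) (loc q Cq vq).
  - exists (v @^-1` [set v p]); last by apply/seteqP; split=> q.
    by apply: closed_comp => // q _; exact: v_cont.
have ZP q : C q -> v q = v p by rewrite -ZC => -[].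
by apply: filterS (C_near x Cx) => y Cy; rewrite !ZP.
Qed.

End harmonic.

(** * Differential identities for an eigenfunction *)

(* The hypotheses say that (P + iQ)^2 = 0. *)
Lemma mxtrace_complex_sqr0 (R : realFieldType) n (P Q : 'M[R]_n) :
  P *m P = Q *m Q -> P *m Q + Q *m P = 0 -> \tr P = 0.
Proof.
move=> PQ PQ0; have := @mxtrace_sqr0 _ _ (block_mx P (- Q) Q P).
rewrite mulmx_block mxtrace_block !mulNmx !mulmxN PQ subrr addNr -opprD PQ0.
rewrite oppr0 [Q *m P + _]addrC PQ0 block_mx0 => /(_ erefl)/eqP.
by rewrite -mulr2n mulrn_eq0 => /eqP.
Qed.

Lemma sym_quadratic_form_eq0 (R : numFieldType) n (A : 'M[R]_n) : A^T = A ->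
  (forall v : 'rV[R]_n, (v *m A *m v^T) 0 0 = 0) -> A = 0.
Proof.
move=> sA qA; apply/matrixP => i j; rewrite mxE.
have form (v w : 'rV[R]_n) : (v *m A *m w^T) 0 0 + (w *m A *m v^T) 0 0 = 0.
  have addE (B C : 'M[R]_1) : (B + C) 0 0 = B 0 0 + C 0 0 by rewrite mxE.
  have := qA (v + w); rewrite linearD/= mulmxDl !mulmxDr !mulmxDl !addE !qA.
  by rewrite add0r addr0 [LHS]addrC.
have E k l : ((delta_mx 0 k : 'rV[R]_n) *m A *m (delta_mx 0 l : 'rV[R]_n)^T) 0 0 = A k l.
  by rewrite -rowE trmx_delta -colE !mxE.
have := form (delta_mx 0 i) (delta_mx 0 j); rewrite !E.
rewrite -{2}sA mxE -mulr2n => /eqP; rewrite mulrn_eq0/= => /eqP//.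
Qed.

Section gradient_form.
Variables (R : realType) (n : nat) (M : smooth_manifold R n).
Variables (g : riemannian_metric M) (c : chart R n M).
Hypothesis atlas_c : atlas c.
Local Notation A := (chart_img c).
Implicit Types (u : 'rV[R]_n -> R) (x v w z : 'rV[R]_n).

Definition gform x (v w : 'rV[R]_n) : R := (v *m gram_inv g c x *m w^T) 0 0.

Definition dform u x : 'rV[R]_n := \row_k partial k u x.

Lemma gformE x v w : gform x v w = \sum_k \sum_l gram_inv g c x k l * (v 0 k * w 0 l).
Proof. exact: bilinear_formE. Qed.

Lemma gformC x v w : A x -> gform x v w = gform x w v.
Proof.
move=> Ax; rewrite !gformE exchange_big/=; apply: eq_bigr => l _.
apply: eq_bigr => k _; rewrite -{1}(gram_inv_sym g atlas_c Ax) mxE.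
by rewrite [v 0 k * _]mulrC.
Qed.

Lemma gformDl x v w z : gform x (v + w) z = gform x v z + gform x w z.
Proof. by rewrite /gform !mulmxDl mxE. Qed.

Lemma gformDr x v w z : gform x z (v + w) = gform x z v + gform x z w.
Proof. by rewrite /gform linearD mulmxDr mxE. Qed.

Lemma gformZl x a v w : gform x (a *: v) w = a * gform x v w.
Proof. by rewrite /gform -!scalemxAl mxE. Qed.

Lemma gformZr x a v w : gform x v (a *: w) = a * gform x v w.
Proof. by rewrite /gform linearZ -scalemxAr mxE. Qed.

Lemma gform0 x v : gform x v 0 = 0.
Proof. by rewrite /gform trmx0 mulmx0 mxE. Qed.

Lemma gform_eq0 x v : A x -> gform x v v = 0 -> v = 0.
Proof.
move=> Ax v0; apply/eqP; apply: contraTT isT => /(gram_inv_posdef g atlas_c Ax).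
by rewrite -/(gform x v v) v0 ltxx.
Qed.

Lemma gform_ge0 x v : A x -> 0 <= gform x v v.
Proof.
move=> Ax; have [->|v0] := eqVneq v 0; first by rewrite gform0.
exact/ltW/(gram_inv_posdef g atlas_c Ax).
Qed.

Lemma grad_form u (u' : 'rV[R]_n -> R) x : A x ->
  \sum_k \sum_l g c x k l * (grad g c u x 0 k * grad g c u' x 0 l) =
  gform x (dform u x) (dform u' x).
Proof.
move=> Ax; rewrite -bilinear_formE /grad -/(dform u x) -/(dform u' x).
rewrite mulmxKV; last exact: metric_unit.
by rewrite trmx_mul mulmxA /gform -{1}[invmx _](gram_inv_sym g atlas_c Ax) trmxK.
Qed.

Lemma kappa_parts (f : M -> R[i]) x : A x ->
  let a := re_rep c f in let b := im_rep c f in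
  kappa g c f f x =
    (gform x (dform a x) (dform a x) - gform x (dform b x) (dform b x))
    +i* (2 * gform x (dform a x) (dform b x)).
Proof.
move=> Ax a b; rewrite /kappa bilinear_formE.
have addE (p q p' q' : R) : (p +i* q) + (p' +i* q') = (p + p') +i* (q + q') by [].
have sumE I (r : seq I) (F G : I -> R) :
    \sum_(i <- r) (F i +i* G i) = (\sum_(i <- r) F i) +i* (\sum_(i <- r) G i).
  elim: r => [|i r IH]; first by rewrite !big_nil.
  by rewrite !big_cons IH addE.
have gba := gformC (dform b x) (dform a x) Ax.
rewrite -!grad_form// in gba *.
pose G k l := g c x k l.
rewrite (_ : 2 * _ = \sum_k \sum_l G k l * (grad g c a x 0 k * grad g c b x 0 l)
  + \sum_k \sum_l G k l * (grad g c b x 0 k * grad g c a x 0 l)); last first.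
  by rewrite /G -gba mulr2n mulrDl !mul1r.
rewrite -sumrB -big_split -sumE; apply: eq_bigr => k _.
rewrite -sumrB -big_split -sumE; apply: eq_bigr => l _.
rewrite !mxE /G -/a -/b.
by apply/eqP; rewrite eq_complex /=; apply/andP; split; apply/eqP; ring.
Qed.

End gradient_form.

Section gradient_limit.
Variables (R : realType) (n : nat) (M : smooth_manifold R n).
Variables (g : riemannian_metric M) (c : chart R n M).
Hypothesis atlas_c : atlas c.
Local Notation A := (chart_img c).

Definition hessian (u : 'rV[R]_n -> R) x : 'M[R]_n :=
  \matrix_(k, l) partial k (partial l u) x.

Lemma hessian_sym u x : A x -> Ck_on 2 A u -> (hessian u x)^T = hessian u x.
Proof.
move=> Ax u2; apply/matrixP => k l; rewrite !mxE.
exact: (partialC (@chart_img_open _ _ _ c) l k u2 Ax).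
Qed.

Lemma laplacian_critical_trace u x : A x -> Ck_on 2 A u -> dform u x = 0 ->
  laplacian g c u x = \tr (gram_inv g c x *m hessian u x).
Proof.
move=> Ax u2 /rowP u0; rewrite (laplacian_critical g atlas_c Ax u2) => [|k].
  apply: eq_bigr => k _; rewrite mxE; apply: eq_bigr => l _.
  by rewrite -(hessian_sym Ax u2) !mxE.
by have := u0 k; rewrite !mxE.
Qed.

Lemma gform_dform_limit u w x v : A x -> Ck_on 2 A u -> Ck_on 2 A w ->
  dform u x = 0 -> dform w x = 0 ->
  h^-1 * h^-1 * gform g c (x + h *: v) (dform u (x + h *: v)) (dform w (x + h *: v))
    @[h --> 0^'] --> gform g c x (v *m hessian u x) (v *m hessian w x).
Proof.
move=> Ax u2 w2 u0 w0; have oA : open A := @chart_img_open _ _ _ c.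
have dlim t k : Ck_on 2 A t -> dform t x = 0 ->
    h^-1 * partial k t (x + h *: v) @[h --> 0^'] --> (v *m hessian t x) 0 k.
  move=> t2 /rowP/(_ k); rewrite !mxE => t0.
  have [d e] := Ck_on_is_derive oA v (Ck_on_partial k t2) Ax.
  have -> : \sum_j v 0 j * hessian t x j k = 'D_v (partial k t) x.
    by rewrite e; apply: eq_bigr => j _; rewrite mxE.
  have -> : (fun h : R => h^-1 * partial k t (x + h *: v)) =
     (fun h : R => h^-1 *: ((partial k t \o shift x) (h *: v) - partial k t x)).
    by apply/funext => h; rewrite /= t0 subr0 [x + _]addrC.
  exact: d.
have glim k l : gram_inv g c (x + h *: v) k l @[h --> 0^'] --> gram_inv g c x k l.
  have cg := Ck_on_continuous (gram_inv_Ck g atlas_c 0 k l) Ax.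
  have cl : {for 0, continuous (fun h : R => x + h *: v)}.
    by apply: continuousD; [exact: cst_continuous|exact: scalel_continuous].
  have : {for 0, continuous (fun h : R => gram_inv g c (x + h *: v) k l)}.
    have cg' : {for x + 0 *: v, continuous (fun y => gram_inv g c y k l)}.
      by rewrite scale0r addr0; exact: cg.
    exact: (continuous_comp cl cg').
  move=> /continuous_withinNx; rewrite scale0r addr0; apply.
rewrite gformE.
have -> : (fun h : R => h^-1 * h^-1 * gform g c (x + h *: v) (dform u (x + h *: v))
      (dform w (x + h *: v))) =
    (fun h : R => \sum_k \sum_l gram_inv g c (x + h *: v) k l *
      ((h^-1 * partial k u (x + h *: v)) * (h^-1 * partial l w (x + h *: v)))).
  apply/funext => h; rewrite gformE mulr_sumr; apply: eq_bigr => k _.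
  rewrite mulr_sumr; apply: eq_bigr => l _; rewrite !mxE.
  by rewrite mulrCA mulrACA.
apply: cvg_big => [|k _]; first exact: add_continuous.
apply: cvg_big => [|l _]; first exact: add_continuous.
apply: cvgM; first exact: glim.
by apply: cvgM; apply: dlim.
Qed.

End gradient_limit.

Section eigenfunction_identities.
Variables (R : realType) (n : nat) (M : smooth_manifold R n).
Variables (g : riemannian_metric M) (lambda mu : R[i]) (f : M -> R[i]).
Hypothesis f_eigen : eigenfunction g lambda mu f.

Definition abs2 p : R := complex.Re (f p) ^+ 2 + complex.Im (f p) ^+ 2.

Lemma re_rep_Ck c k : atlas c -> Ck_on k (chart_img c) (re_rep c f).
Proof. by have [[h _] _] := f_eigen; move=> ac; exact: h. Qed.

Lemma im_rep_Ck c k : atlas c -> Ck_on k (chart_img c) (im_rep c f).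
Proof. by have [[_ h] _] := f_eigen; move=> ac; exact: h. Qed.

Lemma re_continuous : continuous (fun p => complex.Re (f p)).
Proof. by have [[h _] _] := f_eigen; exact: smooth_continuous h. Qed.

Lemma im_continuous : continuous (fun p => complex.Im (f p)).
Proof. by have [[_ h] _] := f_eigen; exact: smooth_continuous h. Qed.

Lemma abs2_continuous : continuous abs2.
Proof.
have -> : abs2 = (fun p => complex.Re (f p) * complex.Re (f p)
    + complex.Im (f p) * complex.Im (f p)).
  by apply/funext => p; rewrite /abs2 !expr2.
move=> p; exact: (continuousD (continuousM (re_continuous (x := p)) (re_continuous (x := p)))
  (continuousM (im_continuous (x := p)) (im_continuous (x := p)))).
Qed.

Lemma abs2_ge0 p : 0 <= abs2 p.
Proof. by rewrite addr_ge0// sqr_ge0. Qed.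

Lemma abs2_eq0 p : abs2 p = 0 -> f p = 0.
Proof.
move=> /eqP; rewrite paddr_eq0 ?sqr_ge0// !sqrf_eq0 => /andP[/eqP r0 /eqP i0].
by case: (f p) r0 i0 => a b /= -> ->.
Qed.

Variables (c : chart R n M) (p : M).
Hypotheses (ac : atlas c) (cp : chart_dom c p).
Let x := c p.
Local Notation A := (chart_img c).
Let a := re_rep c f.
Let b := im_rep c f.

Lemma chart_img_at : A x.
Proof. by exists p. Qed.
Let Ax := chart_img_at.

Lemma re_rep_at : a x = complex.Re (f p).
Proof. by rewrite /a /re_rep /x chart_mapK. Qed.

Lemma im_rep_at : b x = complex.Im (f p).
Proof. by rewrite /b /im_rep /x chart_mapK. Qed.

Lemma eigen_gform_diff :
  gform g c x (dform a x) (dform a x) - gform g c x (dform b x) (dform b x) =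
  complex.Re mu * (complex.Re (f p) ^+ 2 - complex.Im (f p) ^+ 2)
  - complex.Im mu * (2 * (complex.Re (f p) * complex.Im (f p))).
Proof.
have [_ /(_ c ac p cp) [_]] := f_eigen.
rewrite (kappa_parts g ac f Ax) -/a -/b -/x.
case: mu (f p) => [m1 m2] [f1 f2] /= [-> _]; ring.
Qed.

Lemma eigen_gform_cross :
  2 * gform g c x (dform a x) (dform b x) =
  complex.Im mu * (complex.Re (f p) ^+ 2 - complex.Im (f p) ^+ 2)
  + complex.Re mu * (2 * (complex.Re (f p) * complex.Im (f p))).
Proof.
have [_ /(_ c ac p cp) [_]] := f_eigen.
rewrite (kappa_parts g ac f Ax) -/a -/b -/x.
case: mu (f p) => [m1 m2] [f1 f2] /= [_ ->]; ring.
Qed.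

(* Real and imaginary parts of conj(f) df, i.e. |f|^2 times the differentials
   of log |f| and of arg f. *)
Definition dlogabs : 'rV[R]_n := a x *: dform a x + b x *: dform b x.
Definition darg : 'rV[R]_n := a x *: dform b x + (- b x) *: dform a x.

Lemma dlogabs_darg_diff :
  gform g c x dlogabs dlogabs - gform g c x darg darg = complex.Re mu * abs2 p ^+ 2.
Proof.
have e1 := eigen_gform_diff; have e2 := eigen_gform_cross.
have e3 := gformC g ac (dform b x) (dform a x) Ax.
rewrite /dlogabs /darg !(gformDl, gformDr, gformZl, gformZr) e3 {e3}.
rewrite re_rep_at im_rep_at /abs2.
move: e1 e2; move: (gform g c x (dform a x) (dform a x))
  (gform g c x (dform b x) (dform b x)) (gform g c x (dform a x) (dform b x)).
move: (complex.Re (f p)) (complex.Im (f p)) (complex.Re mu) (complex.Im mu).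
move=> r i m1 m2 gaa gbb gab e1 e2.
have -> : gaa = gbb + (m1 * (r ^+ 2 - i ^+ 2) - m2 * (2 * (r * i))) by rewrite -e1; ring.
have -> : gab = (m2 * (r ^+ 2 - i ^+ 2) + m1 * (2 * (r * i))) / 2 by rewrite -e2; field.
by field.
Qed.

Lemma dlogabs_darg_cross : 2 * gform g c x dlogabs darg = complex.Im mu * abs2 p ^+ 2.
Proof.
have e1 := eigen_gform_diff; have e2 := eigen_gform_cross.
have e3 := gformC g ac (dform b x) (dform a x) Ax.
rewrite /dlogabs /darg !(gformDl, gformDr, gformZl, gformZr) e3 {e3}.
rewrite re_rep_at im_rep_at /abs2.
move: e1 e2; move: (gform g c x (dform a x) (dform a x))
  (gform g c x (dform b x) (dform b x)) (gform g c x (dform a x) (dform b x)).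
move: (complex.Re (f p)) (complex.Im (f p)) (complex.Re mu) (complex.Im mu).
move=> r i m1 m2 gaa gbb gab e1 e2.
have -> : gaa = gbb + (m1 * (r ^+ 2 - i ^+ 2) - m2 * (2 * (r * i))) by rewrite -e1; ring.
have -> : gab = (m2 * (r ^+ 2 - i ^+ 2) + m1 * (2 * (r * i))) / 2 by rewrite -e2; field.
by field.
Qed.

End eigenfunction_identities.

Lemma isotropic_trace_eq0 (R : realFieldType) n (G P Q : 'M[R]_n) :
  G^T = G -> P^T = P -> Q^T = Q ->
  (forall v : 'rV[R]_n, (v *m P *m G *m (v *m P)^T) 0 0 =
                        (v *m Q *m G *m (v *m Q)^T) 0 0) ->
  (forall v : 'rV[R]_n, (v *m P *m G *m (v *m Q)^T) 0 0 = 0) ->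
  \tr (G *m P) = 0 /\ \tr (G *m Q) = 0.
Proof.
move=> sG sP sQ q1 q2.
have addE (B C : 'M[R]_1) : (B + C) 0 0 = B 0 0 + C 0 0 by rewrite mxE.
have E1 : P *m G *m P = Q *m G *m Q.
  apply/eqP; rewrite -subr_eq0; apply/eqP; apply: sym_quadratic_form_eq0 => [|v].
    by rewrite linearB/= !trmx_mul sP sQ sG !mulmxA.
  rewrite mulmxBr mulmxBl; have := q1 v; rewrite !trmx_mul sP sQ !mulmxA => e.
  by rewrite mxE e [X in _ + X]mxE subrr.
have E2 : P *m G *m Q + Q *m G *m P = 0.
  apply: sym_quadratic_form_eq0 => [|v].
    by rewrite linearD/= !trmx_mul sP sQ sG !mulmxA addrC.
  rewrite mulmxDr mulmxDl addE; have := q2 v.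
  have : (v *m Q *m G *m (v *m P)^T) 0 0 = 0.
    have tr1 (B : 'M[R]_1) : B^T 0 0 = B 0 0 by rewrite mxE.
    by rewrite -(q2 v) -[LHS]tr1 !trmx_mul !trmxK sG !mulmxA.
  by rewrite !trmx_mul sP sQ !mulmxA => -> ->; rewrite addr0.
have trE (P' Q' : 'M[R]_n) : P' *m G *m P' = Q' *m G *m Q' ->
    P' *m G *m Q' + Q' *m G *m P' = 0 -> \tr (G *m P') = 0.
  move=> e1 e2; apply: (@mxtrace_complex_sqr0 _ _ (G *m P') (G *m Q')).
    by rewrite -!mulmxA [P' *m _]mulmxA [Q' *m _]mulmxA e1.
  by rewrite -!mulmxA -mulmxDr [P' *m _]mulmxA [Q' *m _]mulmxA e2 mulmx0.
by split; [exact: trE E1 E2|apply: trE (esym E1) _; rewrite addrC].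
Qed.

Section eigenfunction_maximum.
Variables (R : realType) (n : nat) (M : smooth_manifold R n).
Variables (g : riemannian_metric M) (lambda mu : R[i]) (f : M -> R[i]).
Hypothesis f_eigen : eigenfunction g lambda mu f.

Definition abs2_rep (c : chart R n M) (y : 'rV[R]_n) : R :=
  re_rep c f y * re_rep c f y + im_rep c f y * im_rep c f y.

Lemma abs2_repE c y : abs2_rep c y = abs2 f (chart_inv c y).
Proof. by rewrite /abs2 !expr2. Qed.

Lemma abs2_rep_Ck c k : atlas c -> Ck_on k (chart_img c) (abs2_rep c).
Proof.
move=> ac; have oA : open (chart_img c) := @chart_img_open _ _ _ c.
have ak := re_rep_Ck f_eigen k ac; have bk := im_rep_Ck f_eigen k ac.
exact: (Ck_on_add oA (Ck_on_mul oA ak ak) (Ck_on_mul oA bk bk)).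
Qed.

Lemma partial_abs2_rep c p k : atlas c -> chart_dom c p ->
  is_derive (c p) (delta_mx 0 k) (abs2_rep c) (2 * dlogabs f c p 0 k).
Proof.
move=> ac cp; have oA : open (chart_img c) := @chart_img_open _ _ _ c.
have Ax := chart_img_at cp.
have da := Ck_on_is_partial k (re_rep_Ck f_eigen 1 ac) Ax.
have db := Ck_on_is_partial k (im_rep_Ck f_eigen 1 ac) Ax.
apply: (is_derive_eq (is_deriveD (is_deriveM da da) (is_deriveM db db))).
by rewrite !mxE mulr_natl mulr2n addrACA.
Qed.

Lemma dlogabs_max c p : atlas c -> chart_dom c p ->
  (\forall q \near p, abs2 f q <= abs2 f p) -> dlogabs f c p = 0.
Proof.
move=> ac cp fmax; have oA : open (chart_img c) := @chart_img_open _ _ _ c.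
have Ax := chart_img_at cp; apply/rowP => k; rewrite [RHS]mxE.
have umax : \forall y \near c p, abs2_rep c y <= abs2_rep c (c p).
  have := chart_near cp fmax; apply: filterS => y.
  by rewrite !abs2_repE chart_mapK.
have := partial_local_max oA k (abs2_rep_Ck 1 ac) Ax umax.
rewrite /partial (derive_val_of (partial_abs2_rep k ac cp)).
by move=> /eqP; rewrite mulf_eq0 pnatr_eq0/= => /eqP.
Qed.

Hypothesis M_closed : closed_manifold M.
Hypothesis f_neq0 : exists x, f x <> 0.

Lemma abs2_max : exists2 p, 0 < abs2 f p & forall q, abs2 f q <= abs2 f p.
Proof.
have [x0 fx0] := f_neq0.
have [|p _ pmax] := compact_EVT_max (ex_intro _ x0 I) M_closed (f := abs2 f).
  exact/continuous_subspaceT/(abs2_continuous f_eigen).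
exists p => [|q]; last by apply: pmax; rewrite inE.
apply: lt_le_trans (pmax x0 _); last by rewrite inE.
rewrite lt_neqAle abs2_ge0 andbT; apply/eqP => /esym/abs2_eq0.
exact: fx0.
Qed.

Lemma eigen_mu_le0 : complex.Im mu = 0 /\ complex.Re mu <= 0.
Proof.
have [p p0 pmax] := abs2_max; have [c ac cp] := atlas_cover p.
have X0 : dlogabs f c p = 0 by apply: dlogabs_max => //; exact: nearW.
have Ax := chart_img_at cp; have p20 : 0 < abs2 f p ^+ 2 by rewrite exprn_gt0.
split.
  have := dlogabs_darg_cross f_eigen ac cp.
  rewrite X0 (gformC g ac) // gform0 mulr0 => /esym/eqP.
  by rewrite mulf_eq0 (gt_eqF p20) orbF => /eqP.
have := dlogabs_darg_diff f_eigen ac cp; rewrite X0 gform0 sub0r => E.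
rewrite -(pmulr_lle0 _ p20) -E oppr_le0.
exact: gform_ge0.
Qed.

Lemma eigen_lambda_eq0 : mu = 0 -> lambda = 0.
Proof.
move=> mu0; have [p p0 pmax] := abs2_max; have [c ac cp] := atlas_cover p.
have X0 : dlogabs f c p = 0 by apply: dlogabs_max => //; exact: nearW.
have Ax := chart_img_at cp; set x := c p in Ax *.
pose a := re_rep c f; pose b := im_rep c f.
have Y0 : darg f c p = 0.
  apply: (gform_eq0 ac Ax (g := g)).
  have := dlogabs_darg_diff f_eigen ac cp.
  by rewrite X0 gform0 sub0r mu0 mul0r => /eqP; rewrite oppr_eq0 => /eqP.
have ab0 : a x * a x + b x * b x != 0.
  by rewrite -[X in X != 0]/(abs2_rep c x) abs2_repE chart_mapK// gt_eqF.
have da0 : dform a x = 0.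
  apply/eqP; have : (a x * a x + b x * b x) *: dform a x == 0.
    rewrite (_ : _ *: _ = a x *: dlogabs f c p - b x *: darg f c p).
      by rewrite X0 Y0 !scaler0 subrr.
    rewrite /dlogabs /darg -/x -/a -/b; apply/rowP => k; rewrite !mxE; ring.
  by rewrite scaler_eq0 (negbTE ab0).
have db0 : dform b x = 0.
  apply/eqP; have : (a x * a x + b x * b x) *: dform b x == 0.
    rewrite (_ : _ *: _ = b x *: dlogabs f c p + a x *: darg f c p).
      by rewrite X0 Y0 !scaler0 addr0.
    rewrite /dlogabs /darg -/x -/a -/b; apply/rowP => k; rewrite !mxE; ring.
  by rewrite scaler_eq0 (negbTE ab0).
have a2 : Ck_on 2 (chart_img c) a := re_rep_Ck f_eigen 2 ac.
have b2 : Ck_on 2 (chart_img c) b := im_rep_Ck f_eigen 2 ac.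
set G := gram_inv g c x; set Ha := hessian a x; set Hb := hessian b x.
have sHa : Ha^T = Ha := hessian_sym Ax a2.
have sHb : Hb^T = Hb := hessian_sym Ax b2.
have sG : G^T = G by exact: gram_inv_sym.
have kappa0 y : chart_img c y ->
    gform g c y (dform a y) (dform a y) = gform g c y (dform b y) (dform b y) /\
    gform g c y (dform a y) (dform b y) = 0.
  case=> q cq <-; have := eigen_gform_diff f_eigen ac cq.
  have := eigen_gform_cross f_eigen ac cq; rewrite mu0/= !mul0r addr0 subr0.
  move=> /eqP; rewrite mulf_eq0 pnatr_eq0/= => /eqP -> /eqP.
  by rewrite subr_eq0 => /eqP ->.
have near_line0 (v : 'rV[R]_n) : \forall h \near 0^', chart_img c (x + h *: v).
  have [d d0 dP] := near_line v (near_open (@chart_img_open _ _ _ c) Ax).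
  by near=> h; apply: dP; near: h; exact: dnbhs0_lt.
have lim_eq (F1 F2 : R -> R) (l1 l2 : R) : F1 h @[h --> 0^'] --> l1 ->
    F2 h @[h --> 0^'] --> l2 -> (\forall h \near 0^', F1 h = F2 h) -> l1 = l2.
  move=> c1 c2 e; apply: (cvg_unique _ c1); first exact: Rhausdorff.
  apply: cvg_trans c2; apply: near_eq_cvg.
  by apply: filterS e => h ->.
have q1 v : gform g c x (v *m Ha) (v *m Ha) = gform g c x (v *m Hb) (v *m Hb).
  have l1 := gform_dform_limit (g := g) (v := v) ac Ax a2 a2 da0 da0.
  have l2 := gform_dform_limit (g := g) (v := v) ac Ax b2 b2 db0 db0.
  apply: (lim_eq _ _ _ _ l1 l2).
  by apply: filterS (near_line0 v) => h /kappa0[-> _].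
have q2 v : gform g c x (v *m Ha) (v *m Hb) = 0.
  have l1 := gform_dform_limit (g := g) (v := v) ac Ax a2 b2 da0 db0.
  apply: (lim_eq _ (fun=> 0) _ _ l1); first exact: cvg_cst.
  by apply: filterS (near_line0 v) => h /kappa0[_ ->]; rewrite mulr0.
have [trA trB] := isotropic_trace_eq0 sG sHa sHb q1 q2.
have La : laplacian g c a x = 0.
  exact: etrans (laplacian_critical_trace g ac Ax a2 da0) trA.
have Lb : laplacian g c b x = 0.
  exact: etrans (laplacian_critical_trace g ac Ax b2 db0) trB.
have [_ /(_ c ac p cp) [+ _]] := f_eigen.
rewrite /complex_laplacian -/a -/b -/x La Lb => /esym/eqP.
rewrite mulf_eq0 => /orP[/eqP//|/eqP fp0].
by move: p0; rewrite /abs2 fp0/= expr0n addr0 ltxx.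
Unshelve. all: by end_near. Qed.

Lemma eigen_locally_constant : mu = 0 -> forall x, \forall y \near x, f y = f x.
Proof.
move=> mu0 x; have l0 := eigen_lambda_eq0 mu0.
have [[sr si] Lf] := f_eigen.
have L0 c : atlas c -> forall y, chart_img c y ->
    laplacian g c (re_rep c f) y = 0 /\ laplacian g c (im_rep c f) y = 0.
  move=> ac y [p cp <-]; have [+ _] := Lf c ac p cp.
  by rewrite l0 mul0r /complex_laplacian => -[-> ->].
have hr : \forall y \near x, complex.Re (f y) = complex.Re (f x).
  apply: (harmonic_locally_constant (g := g) M_closed sr) => c ac y Ay.
  by have [h _] := L0 c ac y Ay; exact: h.
have hi : \forall y \near x, complex.Im (f y) = complex.Im (f x).
  apply: (harmonic_locally_constant (g := g) M_closed si) => c ac y Ay.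
  by have [_ h] := L0 c ac y Ay; exact: h.
apply: filterS2 hr hi => y; case: (f y) (f x) => [a b] [a' b'] /= -> ->.
by [].
Qed.

End eigenfunction_maximum.

(** * Arguments of nonvanishing functions *)

Section argument.
Variable R : realType.
Implicit Types (a b t : R).

(* t is an argument of a + ib != 0: multiplying by e^(-it) gives a positive real. *)
Definition is_arg a b t := b * cos t = a * sin t /\ 0 < a * cos t + b * sin t.

Lemma is_arg_atan a b : 0 < a -> is_arg a b (atan (b / a)).
Proof.
move=> a0; have c0 : 0 < cos (atan (b / a)).
  by apply: cos_gt0_pihalf; rewrite atan_gtNpi2 atan_ltpi2.
have sE : sin (atan (b / a)) = b / a * cos (atan (b / a)).
  have := atanK (b / a); rewrite /tan => e.
  by rewrite -[X in _ = X * _]e divfK// gt_eqF.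
rewrite /is_arg sE; split; first by rewrite mulrA mulrCA mulfV ?mulr1// gt_eqF.
rewrite mulrA -mulrDl pmulr_lgt0// ltr_wpDr// mulrA divr_ge0 ?(ltW a0)//.
exact: sqr_ge0.
Qed.

Lemma is_arg_mul a b t a' b' t' : is_arg a b t -> is_arg a' b' t' ->
  is_arg (a * a' - b * b') (a * b' + b * a') (t + t').
Proof.
rewrite /is_arg sinD cosD => -[e p] [e' p'].
move: (cos t) (sin t) (cos t') (sin t') e p e' p' => c s c' s' e p e' p'.
split.
  apply/eqP; rewrite -subr_eq0; apply/eqP.
  rewrite (_ : _ - _ = (b * c - a * s) * (a' * c' + b' * s') +
    (a * c + b * s) * (b' * c' - a' * s')); last by ring.
  by rewrite e e' !subrr mul0r mulr0 addr0.
rewrite (_ : _ + _ = (a * c + b * s) * (a' * c' + b' * s') -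
  (b * c - a * s) * (b' * c' - a' * s')); last by ring.
by rewrite e subrr mul0r subr0 mulr_gt0.
Qed.

Lemma is_arg_scale a b t r : 0 < r -> is_arg a b t <-> is_arg (r * a) (r * b) t.
Proof.
move=> r0; rewrite /is_arg -!mulrA -mulrDr pmulr_rgt0//.
split=> -[e p]; split=> //; first by rewrite e.
by move/mulfI: e; apply; rewrite gt_eqF.
Qed.

Lemma is_arg_unique a b t t' : is_arg a b t -> is_arg a b t' ->
  sin (t - t') = 0 /\ 0 < cos (t - t').
Proof.
move=> [e p] [e' p']; rewrite sinB cosB.
have cs := cos2Dsin2 t; have cs' := cos2Dsin2 t'.
move: (cos t) (sin t) (cos t') (sin t') e p e' p' cs cs' => c s c' s' e p e' p' cs cs'.
pose r := a * c + b * s.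
have ra : a = r * c.
  by rewrite -[LHS]mulr1 -cs /r; transitivity (a * c ^+ 2 + s * (a * s)); [ring|rewrite -e; ring].
have rb : b = r * s.
  by rewrite -[LHS]mulr1 -cs /r; transitivity (b * s ^+ 2 + c * (b * c)); [ring|rewrite e; ring].
have r0 : 0 < r by [].
split.
  apply: (mulfI (lt0r_neq0 r0)); rewrite mulr0 mulrBr !mulrA -ra -rb.
  by rewrite e' subrr.
rewrite -(pmulr_rgt0 _ r0) mulrDr !mulrA -ra -rb//.
Qed.

(* The condition says that a' + ib' lies in the open half-plane centred at
   a + ib; the arctangent is the principal argument of their quotient. *)
Lemma is_arg_step a b a' b' t : is_arg a b t -> 0 < a' * a + b' * b ->
  is_arg a' b' (t + atan ((b' * a - a' * b) / (a' * a + b' * b))).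
Proof.
move=> zt w0.
have n0 : 0 < a * a + b * b.
  rewrite lt_neqAle addr_ge0 ?sqr_ge0// andbT eq_sym paddr_eq0 ?sqr_ge0//.
  apply/negP => /andP[]; rewrite !mulf_eq0 !orbb => /eqP a0 /eqP b0.
  by move: w0; rewrite a0 b0 !mulr0 addr0 ltxx.
apply/(is_arg_scale _ _ _ n0).
have := is_arg_mul zt (is_arg_atan (b' * a - a' * b) w0).
congr is_arg; ring.
Qed.

Lemma is_arg_exists a b : 0 < a * a + b * b -> exists t, is_arg a b t.
Proof.
move=> n0.
have [a0|a0|a0] := ltgtP 0 a; first by exists (atan (b / a)); exact: is_arg_atan.
- have h : is_arg (-1) 0 pi by rewrite /is_arg sinpi cospi; split; lra.
  by eexists; apply: (is_arg_step h); lra.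
- have [b0|b0|b0] := ltgtP 0 b.
  + have h : is_arg 0 1 (pi / 2) by rewrite /is_arg sin_pihalf cos_pihalf; split; lra.
    by eexists; apply: (is_arg_step h); lra.
  + have h : is_arg 0 (-1) (- (pi / 2)).
      by rewrite /is_arg sinN cosN sin_pihalf cos_pihalf; split; lra.
    by eexists; apply: (is_arg_step h); lra.
  + by move: n0; rewrite -a0 -b0 !mulr0 addr0 ltxx.
Qed.

(* The condition on h s says that it is a multiple of 2 pi. *)
Lemma continuous_period_constant (h : R -> R) : {within `[0, 1], continuous h} ->
  (forall s, 0 <= s <= 1 -> sin (h s) = 0 /\ 0 < cos (h s)) -> h 0 = h 1.
Proof.
move=> hc hP.
wlog lt01 : h hc hP / h 0 < h 1.
  move=> H; have [lt|lt|//] := ltgtP (h 0) (h 1); first exact: H.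
  apply: oppr_inj; apply: (H (fun s => - h s)) => [|s /hP[h1 h2]|].
  - by move=> s; apply: continuousN; exact: hc.
  - by rewrite sinN cosN h1 oppr0.
  - by rewrite ltrN2.
exfalso; pose v := Num.min (h 1) (h 0 + pi / 2).
have pi2 : 0 < pi / 2 :> R by rewrite divr_gt0// pi_gt0.
have v0 : h 0 < v by rewrite lt_min lt01 ltrDl.
have v1 : v <= h 0 + pi / 2 by rewrite ge_min lexx orbT.
have vI : Num.min (h 0) (h 1) <= v <= Num.max (h 0) (h 1).
  by rewrite (min_l (ltW lt01)) (max_r (ltW lt01)) (ltW v0)/= ge_min lexx.
have [s] := IVT ler01 hc vI; rewrite in_itv/= => sI hs.
have [s1 s2] := hP s sI; have [s3 s4] := hP 0 (introT andP (conj (lexx 0) ler01)).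
have : 0 < sin (v - h 0).
  apply: sin_gt0_pi; rewrite subr_gt0 v0/= ltrBlDl (le_lt_trans v1)// ltrD2l.
  by rewrite ltr_pdivrMr// ltr_pMr ?pi_gt0// ltr1n.
by rewrite -hs sinB s1 s3 mul0r mulr0 subrr ltxx.
Qed.

End argument.

Lemma continuous_compose (T U W : topologicalType) (h : T -> U) (k : U -> W) :
  continuous h -> continuous k -> continuous (fun x => k (h x)).
Proof. by move=> ch ck x; exact: (continuous_comp (ch x) (ck (h x))). Qed.

Lemma arg_step_continuous (R : realType) (T : topologicalType) (a b : T -> R)
    (a0 b0 th : R) (t : T) :
  {for t, continuous a} -> {for t, continuous b} -> a t * a0 + b t * b0 != 0 ->
  {for t, continuous (fun s =>
    th + atan ((b s * a0 - a s * b0) / (a s * a0 + b s * b0)))}.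
Proof.
move=> ca cb d0.
have k (r : R) : {for t, continuous (fun _ : T => r)} by exact: cst_continuous.
have cn : {for t, continuous (fun s => b s * a0 - a s * b0)}.
  exact: (continuousB (continuousM cb (k a0)) (continuousM ca (k b0))).
have cd : {for t, continuous (fun s => a s * a0 + b s * b0)}.
  exact: (continuousD (continuousM ca (k a0)) (continuousM cb (k b0))).
have cr : {for t, continuous (fun s =>
    (b s * a0 - a s * b0) / (a s * a0 + b s * b0))}.
  by apply: continuousM; [exact: cn|apply: continuousV; [exact: d0|exact: cd]].
exact: (continuousD (k th) (continuous_comp cr (@continuous_atan R _))).
Qed.

Lemma val_continuous (T : topologicalType) (A : set T) :
  continuous (val : A -> T).
Proof. exact: initial_continuous. Qed.

Lemma continuous_into_subtype (S T : topologicalType) (A : set T) (h : S -> A) :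
  continuous (fun s => val (h s)) -> continuous h.
Proof. by move=> ch; exact: (@continuous_comp_initial _ _ _ (set_val : A -> T)). Qed.

Lemma nbhs_subtype (T : topologicalType) (A : set T) (t : A) (P : A -> Prop) :
  (\forall s \near t, P s) ->
  \forall x \near val t, forall s : A, val s = x -> P s.
Proof.
move=> [_ [[W oW <-] Wt WP]].
have nW : \forall x \near val t, W x by apply: open_nbhs_nbhs.
by apply: filterS nW => x Wx s sx; apply: WP; rewrite /= set_valE sx.
Qed.

Section argument_lift.
Variables (R : realType) (V : normedModType R) (A : set V).
Hypothesis A_compact : compact A.
Hypothesis A_convex : forall x y (s : R), A x -> A y -> 0 <= s <= 1 ->
  A (x + s *: (y - x)).

Definition clamp (s : R) : R := (`|s| - `|s - 1| + 1) / 2.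

Lemma clamp_continuous : continuous clamp.
Proof.
move=> s.
have c1 : {for s, continuous (fun s : R => s - 1)}.
  by apply: continuousB; [exact: cvg_id|exact: cst_continuous].
have c2 := continuous_comp c1 (@norm_continuous _ R (s - 1)).
have c3 : {for s, continuous (fun s : R => `|s| - `|s - 1| + 1)}.
  apply: continuousD; last exact: cst_continuous.
  exact: (continuousB (@norm_continuous _ R s) c2).
have c4 : {for s, continuous (fun s : R => 2^-1 : R)} by exact: cst_continuous.
exact: (continuousM c3 c4).
Qed.

Lemma clamp01 s : 0 <= clamp s <= 1.
Proof.
rewrite /clamp; apply/andP; split.
  by rewrite divr_ge0//; have := ler_normB s 1; rewrite normr1; lra.
rewrite ler_pdivrMr// mul1r; have := ler_normD (s - 1) 1.
by rewrite subrK normr1; lra.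
Qed.

Lemma clampE s : 0 <= s <= 1 -> clamp s = s.
Proof.
move=> /andP[s0 s1]; rewrite /clamp ger0_norm// ler0_norm ?subr_le0//.
by field.
Qed.

Definition seg (x y : A) (s : R) : A :=
  SigSub (mem_set (A_convex (set_valP x) (set_valP y) (clamp01 s))).

Lemma seg_val x y s : val (seg x y s) = val x + clamp s *: (val y - val x).
Proof. by []. Qed.

Lemma seg0 x y : seg x y 0 = x.
Proof.
by apply: val_inj; rewrite seg_val clampE ?lexx ?ler01// scale0r addr0.
Qed.

Lemma seg1 x y : seg x y 1 = y.
Proof.
by apply: val_inj; rewrite seg_val clampE ?lexx ?ler01// scale1r addrC subrK.
Qed.

Lemma seg_continuous x y : continuous (seg x y).
Proof.
apply: continuous_into_subtype => s.
have c0 : {for s, continuous (fun _ : R => val x)} by exact: cst_continuous.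
have c1 : {for s, continuous (fun s => clamp s *: (val y - val x))}.
  exact: (continuous_comp (clamp_continuous (x := s))
    (@scalel_continuous _ _ (val y - val x) (clamp s))).
exact: (continuousD c0 c1).
Qed.

Lemma seg_continuousr x s : continuous (fun y => seg x y s).
Proof.
apply: continuous_into_subtype => y.
have c0 : {for y, continuous (fun _ : A => val x)} by exact: cst_continuous.
have c1 : {for y, continuous (fun y : A => val y - val x)}.
  have cv : {for y, continuous (val : A -> V)} by exact: val_continuous.
  exact: (continuousB cv c0).
have c2 := continuous_comp c1 (@scaler_continuous _ _ (clamp s) (val y - val x)).
exact: (continuousD c0 c2).
Qed.

Definition is_lift (a b l : A -> R) :=
  continuous l /\ forall t, is_arg (a t) (b t) (l t).

Lemma lift_unique (a b l l' : A -> R) (t t' : A) :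
  is_lift a b l -> is_lift a b l' -> l t - l' t = l t' - l' t'.
Proof.
move=> [cl al] [cl' al'].
pose h s := l (seg t t' s) - l' (seg t t' s).
suff : h 0 = h 1 by rewrite /h seg0 seg1.
apply: continuous_period_constant => [|s _].
  apply: continuous_subspaceT => s; apply: continuousB.
    exact: (continuous_comp (@seg_continuous t t' s) (cl _)).
  exact: (continuous_comp (@seg_continuous t t' s) (cl' _)).
exact: is_arg_unique (al _) (al' _).
Qed.

Variables a b : A -> R.
Hypotheses (a_cont : continuous a) (b_cont : continuous b).
Hypothesis ab_neq0 : forall t, 0 < a t * a t + b t * b t.

Lemma uniform_half_plane : exists2 d : R, 0 < d &
  forall t t' : A, `|val t - val t'| < d -> 0 < a t' * a t + b t' * b t.
Proof.
pose P (d : R) (x : V) := forall t t' : A, val t = x -> `|val t - val t'| < d ->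
  0 < a t' * a t + b t' * b t.
have : \forall d \near 0^'+, A `<=` P d.
  apply: ((compact_near_coveringP A).1 A_compact) => x Ax.
  pose t0 : A := SigSub (mem_set Ax).
  have H : \forall u \near (t0, t0), 0 < a u.2 * a u.1 + b u.2 * b u.1.
    pose F (u : A * A) := a u.2 * a u.1 + b u.2 * b u.1.
    have cF : {for (t0, t0), continuous F}.
      have c1 (h : A -> R) : continuous h -> {for (t0, t0), continuous (fun u : A * A => h u.1)}.
        by move=> ch; apply: (continuous_comp (f := fst)); [exact: cvg_fst|exact: ch].
      have c2 (h : A -> R) : continuous h -> {for (t0, t0), continuous (fun u : A * A => h u.2)}.
        by move=> ch; apply: (continuous_comp (f := snd)); [exact: cvg_snd|exact: ch].
      by apply: continuousD; apply: continuousM; first [exact: c1|exact: c2].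
    by have := cF _ (lt_nbhsr (ab_neq0 t0)).
  case: H => -[U W] /= [nU nW] UW.
  have nU' := nbhs_subtype nU; have nW' := nbhs_subtype nW.
  have [r r0 rP] : exists2 r : R, 0 < r & forall z, `|x - z| < r ->
      (forall s : A, val s = z -> U s) /\ (forall s : A, val s = z -> W s).
    have : \forall z \near x, (forall s : A, val s = z -> U s) /\
      (forall s : A, val s = z -> W s) by apply: filterI.
    by move=> /nbhs_normP[r r0 rP]; exists r.
  have r2 : 0 < r / 2 by rewrite divr_gt0.
  exists ([set z | `|x - z| < r / 2], [set d | d < r / 2]) => /=.
    split; first by apply/nbhs_normP; exists (r / 2).
    exact: nbhs_right_lt.
  move=> [z d] /= [zr dr] t t' tz tt'.
  apply: (UW (t, t')); split=> /=.
    have zr' : `|x - z| < r.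
      by rewrite (lt_trans zr)// ltr_pdivrMr// ltr_pMr// ltr1n.
    by have [h _] := rP z zr'; exact: h.
  have tr : `|x - val t'| < r.
    rewrite [r]splitr -(subrKA z) (le_lt_trans (ler_normD _ _))// ltrD//.
    by rewrite -tz (lt_trans tt').
  by have [_ h] := rP (val t') tr; exact: h.
move=> H.
have [d [d0 dP]] : exists d : R, 0 < d /\ A `<=` P d.
  by near ((0 : R)^'+) => d; exists d; split; near: d; first exact: nbhs_right_gt.
by exists d => // t t' tt'; apply: (dP (val t)) => //; exact: set_valP.
Unshelve. all: by end_near. Qed.

(* The lift adds up the principal arguments of successive quotients along the
   segment from t0 to t, with steps short enough for the quotients to stay in the
   right half-plane. *)
Lemma lift_exists (t0 : A) : exists l, is_lift a b l.
Proof.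
have [d d0 dP] := uniform_half_plane.
have [D D0 DP] : exists2 D : R, 0 < D & forall t : A, `|val t - val t0| <= D.
  have [m [mr mP]] := compact_bounded A_compact.
  pose m' := `|m| + 1.
  have mm' : m < m' by rewrite (le_lt_trans (ler_norm _))// ltrDl.
  exists (m' + m') => [|t]; first by rewrite addr_gt0// ltr_wpDl.
  rewrite (le_trans (ler_normB _ _))// lerD//; apply: mP => //; exact: set_valP.
pose N := (Num.truncn (D / d)).+1.
have N0 : 0 < N%:R :> R by rewrite ltr0n.
have DN : D / N%:R < d.
  rewrite ltr_pdivrMr// mulrC -ltr_pdivrMr//.
  exact: truncnS_gt.
pose p (j : nat) (t : A) := seg t0 t (j%:R / N%:R).
have pc j : continuous (p j) by exact: seg_continuousr.
have step j t : (j < N)%N ->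
    0 < a (p j.+1 t) * a (p j t) + b (p j.+1 t) * b (p j t).
  move=> jN; apply: dP; rewrite !seg_val !clampE; last 2 first.
  - by rewrite divr_ge0//= ler_pdivrMr// mul1r ler_nat.
  - by rewrite divr_ge0//= ler_pdivrMr// mul1r ler_nat ltnW.
  rewrite opprD addrACA subrr add0r -scalerBl -mulrBl -[j.+1]addn1 natrD.
  rewrite opprD addrA subrr add0r mulN1r scaleNr normrN normrZ.
  rewrite ger0_norm ?invr_ge0 ?(ltW N0)//; apply: le_lt_trans DN.
  by rewrite mulrC ler_wpM2r// invr_ge0 ltW.
have H j : (j <= N)%N -> exists2 l : A -> R, continuous l &
    forall t, is_arg (a (p j t)) (b (p j t)) (l t).
  elim: j => [_|j IH jN].
    have [th thP] := is_arg_exists (ab_neq0 t0).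
    exists (fun=> th) => [|t]; first by move=> t; exact: cst_continuous.
    by rewrite /p mul0r seg0.
  have [l cl lP] := IH (ltnW jN).
  pose q t := (b (p j.+1 t) * a (p j t) - a (p j.+1 t) * b (p j t)) /
     (a (p j.+1 t) * a (p j t) + b (p j.+1 t) * b (p j t)).
  exists (fun t => l t + atan (q t)) => t; last exact: is_arg_step (lP t) (step j t jN).
  have ca k : {for t, continuous (fun t => a (p k t))}.
    exact: (continuous_comp (pc k t) (a_cont (x := p k t))).
  have cb k : {for t, continuous (fun t => b (p k t))}.
    exact: (continuous_comp (pc k t) (b_cont (x := p k t))).
  have cq : {for t, continuous q}.
    apply: continuousM.
      by apply: continuousB; apply: continuousM; [exact: cb|exact: ca|exact: ca|exact: cb].
    apply: continuousV; first by rewrite gt_eqF// step.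
    by apply: continuousD; apply: continuousM; [exact: ca|exact: ca|exact: cb|exact: cb].
  by apply: continuousD; [exact: cl|exact: (continuous_comp cq (@continuous_atan _ (q t)))].
have [l cl lP] := H N (leqnn N); exists l; split=> // t.
by have := lP t; rewrite /p divff ?gt_eqF// seg1.
Qed.

End argument_lift.

(** * Winding of rational chains *)

(* R as a rational vector space: fglift needs a module over the coefficients of
   the chains. *)
Definition rat_module (R : realType) : Type := R.

HB.instance Definition _ (R : realType) := GRing.Zmodule.on (rat_module R).

Section rat_module.
Variable R : realType.
Definition rat_scale (q : rat) (x : rat_module R) : rat_module R := ratr q * (x : R).
Lemma rat_scaleA p q x : rat_scale p (rat_scale q x) = rat_scale (p * q) x.
Proof. by rewrite /rat_scale mulrA rmorphM. Qed.
Lemma rat_scale1 : left_id 1 rat_scale.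
Proof. by move=> x; rewrite /rat_scale rmorph1 mul1r. Qed.
Lemma rat_scaleDr : right_distributive rat_scale +%R.
Proof. by move=> q x y; rewrite /rat_scale mulrDr. Qed.
Lemma rat_scaleDl x : {morph rat_scale^~ x : p q / p + q}.
Proof. by move=> p q; rewrite /rat_scale rmorphD mulrDl. Qed.
HB.instance Definition _ := GRing.Zmodule_isLmodule.Build rat (rat_module R)
  rat_scaleA rat_scale1 rat_scaleDr rat_scaleDl.
End rat_module.


Section fglift_linear.
Variables (F : nzRingType) (K : choiceType) (U : lmodType F) (h : K -> U).
Implicit Types D : {freeg K / F}.

HB.instance Definition _ := GRing.isAdditive.Build {freeg K / F} U (fglift h)
  (lift_is_additive h).

Lemma fgliftB : {morph fglift h : D D' / D - D'}. Proof. exact: raddfB. Qed.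
Lemma fgliftD : {morph fglift h : D D' / D + D'}. Proof. exact: raddfD. Qed.

Lemma fglift_sum I (r : seq I) (D : I -> {freeg K / F}) :
  fglift h (\sum_(i <- r) D i) = \sum_(i <- r) fglift h (D i).
Proof. exact: (raddf_sum (fglift h)). Qed.

Lemma fglift1 x : fglift h << x >> = h x.
Proof. by rewrite liftU scale1r. Qed.

Lemma fglift_sumE D : fglift h D = \sum_(x <- dom D) coeff x D *: h x.
Proof.
rewrite -[in LHS](freeg_sumE D) fglift_sum; apply: eq_bigr => x _.
exact: liftU.
Qed.

Lemma fgliftZ (c : F) D : fglift h (c *: D) = c *: fglift h D.
Proof.
rewrite -[in LHS](freeg_sumE D) scaler_sumr fglift_sum.
rewrite [in RHS]fglift_sumE scaler_sumr.
apply: eq_bigr => x _; rewrite scalerA -(liftU h (c * coeff x D) x).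
congr (fglift h _); apply/eqP/freeg_eqP => y.
by rewrite coeffZ !coeffU mulrA.
Qed.

End fglift_linear.

Lemma fglift_comp_eq0 (F : nzRingType) (K K' : choiceType) (U : lmodType F)
    (h : K -> {freeg K' / F}) (h' : K' -> U) :
  (forall x, fglift h' (h x) = 0) -> forall D, fglift h' (fglift h D) = 0.
Proof.
move=> h0 D; rewrite (fglift_sumE h).
rewrite (fglift_sum h') big1// => x _.
by rewrite (fgliftZ h') h0 scaler0.
Qed.

Lemma betti1_eq0_cycle (R : realType) (X : topologicalType) (z : chain R X 1) :
  betti1 R X = 0%E -> boundary z = 0 ->
  exists2 q : rat, q != 0 & exists b : chain R X 2, boundary b = q *: z.
Proof.
move=> b0 z0; apply: contrapT => H.
have ind : @independent_classes R X 1 (fun=> z).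
  split=> // a [b ba] i; apply: contrapT => /eqP ai; apply: H.
  by exists (a i) => //; exists b; rewrite ba big_ord1 (ord1 i).
have : (1%:E <= betti1 R X)%E.
  by apply: ereal_sup_ubound; exists 1%N => //; exists (fun=> z).
by rewrite b0 lee_fin ler10.
Qed.

Section std_simplex.
Variable R : realType.

Lemma std_simplex_compact k : compact (@std_simplex R k).
Proof.
pose B := [set v : 'rV[R]_k.+1 | forall i, v ord0 i \in `[0, 1]%R].
have cB : compact B.
  have := @rV_compact R k.+1 (fun=> `[0, 1]%classic) (fun=> @segment_compact R 0 1).
  exact.
have -> : @std_simplex R k = B `&` (fun t : 'rV[R]_k.+1 => \sum_i t 0 i) @^-1` [set 1].
  apply/seteqP; split=> t [t0 t1]; split=> // i.
    rewrite in_itv/= t0 -t1 (bigD1 i)//= lerDl.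
    by apply: sumr_ge0 => j _; exact: t0.
  by have := t0 i; rewrite in_itv/= => /andP[].
apply: compact_closedI => //.
apply: closed_comp => [t _|]; last exact: closed_eq.
apply: (Ck_on_continuous (A := setT) (k := 0%N)) => //.
apply: Ck_on_sum => [|i]; first exact: openT.
exact: Ck_on_coord openT _ _.
Qed.

Lemma std_simplex_convex k (x y : 'rV[R]_k.+1) (s : R) : std_simplex x ->
  std_simplex y -> 0 <= s <= 1 -> std_simplex (x + s *: (y - x)).
Proof.
move=> [x0 x1] [y0 y1] /andP[s0 s1]; split=> [i|].
  rewrite !mxE (_ : _ + _ = (1 - s) * x 0 i + s * y 0 i); last by ring.
  by rewrite addr_ge0// mulr_ge0// subr_ge0.
rewrite (eq_bigr (fun i => (1 - s) * x 0 i + s * y 0 i)) => [|i _].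
  by rewrite big_split/= -!mulr_sumr x1 y1 !mulr1 subrK.
by rewrite !mxE; ring.
Qed.

Lemma simplex0_subproof : (const_mx 1 : 'rV[R]_1) \in @std_simplex R 0.
Proof.
by apply/mem_set; split=> [i|]; rewrite ?big_ord1 mxE.
Qed.

Definition point0 : @std_simplex R 0 := SigSub simplex0_subproof.

Lemma point0_unique (t : @std_simplex R 0) : t = point0.
Proof.
apply: val_inj; apply/rowP => i; rewrite mxE ord1.
by have [_] := set_valP t; rewrite big_ord1.
Qed.

Lemma face_delta k (i : 'I_k.+2) (l : 'I_k.+1) (t : @std_simplex R k) :
  val t = delta_mx 0 l -> val (face i t) = delta_mx 0 (fintype.lift i l).
Proof.
move=> tl; apply/rowP => m; rewrite /= !mxE tl.
case: unliftP => [m' ->|->].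
  by rewrite !mxE !eqxx/= (inj_eq (@lift_inj _ i)).
by rewrite eqxx/= (negbTE (neq_lift i l)).
Qed.

Lemma face_point0 (i j : 'I_3) (k l : 'I_2) :
  bump i (bump k 0) = bump j (bump l 0) ->
  face i (face k point0) = face j (face l point0).
Proof.
move=> e; have p0 : val point0 = delta_mx 0 ord0.
  by apply/rowP => m; rewrite ord1 !mxE.
apply: val_inj; rewrite (face_delta i (face_delta k p0)).
rewrite (face_delta j (face_delta l p0)); congr delta_mx.
exact: val_inj.
Qed.

End std_simplex.

Section winding.
Variables (R : realType) (X : topologicalType) (a b : X -> R).
Hypotheses (a_cont : continuous a) (b_cont : continuous b).
Hypothesis ab_neq0 : forall x, 0 < a x * a x + b x * b x.

Lemma simplex_lift k (s : singular_simplex R X k) (t0 : @std_simplex R k) :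
  exists l, is_lift (a \o s) (b \o s) l.
Proof.
apply: lift_exists t0.
- exact: std_simplex_compact.
- by move=> x y r; exact: std_simplex_convex.
- exact: (continuous_compose (@cts_fun _ _ s) a_cont).
- exact: (continuous_compose (@cts_fun _ _ s) b_cont).
- by move=> t; exact: ab_neq0.
Qed.

Definition simplex_arg (s : singular_simplex R X 1) : @std_simplex R 1 -> R :=
  sval (cid (simplex_lift s (face ord0 (point0 R)))).

Definition arg_increment (s : singular_simplex R X 1) : rat_module R :=
  simplex_arg s (face ord0 (point0 R)) - simplex_arg s (face ord_max (point0 R)).

Lemma arg_incrementE (s : singular_simplex R X 1) l :
  is_lift (a \o s) (b \o s) l ->
  arg_increment s = l (face ord0 (point0 R)) - l (face ord_max (point0 R)).
Proof.
move=> ll; rewrite /arg_increment /simplex_arg; case: cid => l' ll' /=.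
have := lift_unique (@std_simplex_convex R 1) (face ord0 (point0 R))
  (face ord_max (point0 R)) ll ll'.
lra.
Qed.

Definition winding : chain R X 1 -> rat_module R := fglift arg_increment.

Lemma winding_boundary (c : chain R X 2) : winding (boundary c) = 0.
Proof.
apply: fglift_comp_eq0 => s.
have [l [cl al]] := simplex_lift s (face ord0 (face ord0 (point0 R))).
have face_lift i : is_lift (a \o simplex_face i s) (b \o simplex_face i s) (l \o face i).
  split=> [|t]; last exact: al.
  exact: (continuous_compose (@face_continuous R 1 i) cl).
rewrite fglift_sum !big_ord_recl big_ord0 !fgliftZ !fglift1.
set i1 := fintype.lift ord0 ord0; set i2 := fintype.lift ord0 (fintype.lift ord0 ord0).
have -> : (-1) ^+ @ord0 2 = 1 :> rat by [].
have -> : (-1) ^+ i1 = -1 :> rat by [].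
have -> : (-1) ^+ i2 = 1 :> rat by [].
rewrite !scale1r scaleN1r !(arg_incrementE (face_lift _)) /= addr0 opprB.
rewrite (@face_point0 R i1 ord0 ord0 ord0 erefl).
rewrite (@face_point0 R i2 ord0 ord0 ord_max erefl).
rewrite (@face_point0 R i2 i1 ord_max ord_max erefl).
by rewrite addrA [X in X + _]addrC subrKA subrKA subrr.
Qed.

Hypothesis X_betti1 : betti1 R X = 0%E.

Lemma winding_cycle (z : chain R X 1) : boundary z = 0 -> winding z = 0.
Proof.
move=> /(betti1_eq0_cycle X_betti1)[q q0 [c cz]].
have := winding_boundary c; rewrite cz /winding fgliftZ => /eqP.
by rewrite scaler_eq0 (negbTE q0) => /eqP.
Qed.

Lemma winding_path (c c' : chain R X 1) : boundary c = boundary c' ->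
  winding c = winding c'.
Proof.
move=> cc'; apply/eqP; rewrite -subr_eq0; apply/eqP.
rewrite /winding -fgliftB; apply: winding_cycle.
by rewrite /boundary fgliftB -/(boundary c) -/(boundary c') cc' subrr.
Qed.

Definition simplex_point (x : X) : singular_simplex R X 0 :=
  mkcts (@cst_continuous (@std_simplex R 0) X x).

Lemma boundary1 (s : singular_simplex R X 1) (x y : X) :
  s (face ord_max (point0 R)) = x -> s (face ord0 (point0 R)) = y ->
  boundary << s >> = << simplex_point y >> - << simplex_point x >>.
Proof.
move=> sx sy; rewrite /boundary fglift1 !big_ord_recl big_ord0 addr0.
have -> : (-1) ^+ @ord0 1 = 1 :> rat by [].
have -> : (-1) ^+ fintype.lift ord0 (@ord0 0) = -1 :> rat by [].
have -> : fintype.lift ord0 (@ord0 0) = ord_max :> 'I_2 by exact: val_inj.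
rewrite scale1r scaleN1r.
have -> : simplex_face ord0 s = simplex_point y.
  by apply/continuousEP => t; rewrite (point0_unique t) -sy.
have -> : simplex_face ord_max s = simplex_point x.
  by apply/continuousEP => t; rewrite (point0_unique t) -sx.
by [].
Qed.

Lemma arg_increment_half_plane (s : singular_simplex R X 1) :
  let x := s (face ord_max (point0 R)) in let y := s (face ord0 (point0 R)) in
  (forall t, 0 < a (s t) * a x + b (s t) * b x) ->
  arg_increment s = atan ((b y * a x - a y * b x) / (a y * a x + b y * b x)).
Proof.
move=> x y hs; have [th thP] := is_arg_exists (ab_neq0 x).
pose l t := th + atan ((b (s t) * a x - a (s t) * b x) / (a (s t) * a x + b (s t) * b x)).
have ll : is_lift (a \o s) (b \o s) l.
  split=> t; last exact: is_arg_step thP (hs _).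
  apply: (@arg_step_continuous _ _ (fun t => a (s t)) (fun t => b (s t))).
  - exact: (continuous_compose (@cts_fun _ _ s) a_cont).
  - exact: (continuous_compose (@cts_fun _ _ s) b_cont).
  - by rewrite gt_eqF// hs.
rewrite (arg_incrementE ll) /l -/x -/y [b x * a x]mulrC subrr mul0r atan0.
by rewrite addr0 addrAC subrr add0r.
Qed.

End winding.

Section argument_on_component.
Variables (R : realType) (n : nat) (M : smooth_manifold R n) (O : set M) (x0 : M).
Hypothesis O_open : open O.
Local Notation C := (connected_component O x0).
Variables a b : M -> R.
Hypotheses (a_cont : continuous a) (b_cont : continuous b).
Hypothesis ab_neq0 : forall x, C x -> 0 < a x * a x + b x * b x.

Lemma chart_segment (q : C) : \forall p \near val q,
  exists s : singular_simplex R C 1,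
    [/\ s (face ord_max (point0 R)) = q, val (s (face ord0 (point0 R))) = p &
    forall t, 0 < a (val (s t)) * a (val q) + b (val (s t)) * b (val q)].
Proof.
have Cq := set_valP q.
pose F y := a y * a (val q) + b y * b (val q).
have cF : {for val q, continuous F}.
  have k (r : R) : {for val q, continuous (fun _ : M => r)} by exact: cst_continuous.
  exact: (continuousD (continuousM (a_cont (x := _)) (k (a (val q))))
    (continuousM (b_cont (x := _)) (k (b (val q))))).
have nP : \forall y \near val q, C y /\ 0 < F y.
  have n1 := component_near O_open Cq.
  have n2 : \forall y \near val q, 0 < F y.
    by have := cF _ (lt_nbhsr (ab_neq0 Cq)).
  by near=> y; split; near: y.
have [c [r [ac cq] [r0 rP]]] := chart_ball nP.
have nr : \forall p \near val q, chart_dom c p /\ `|c (val q) - c p| < r.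
  have n1 : \forall p \near val q, chart_dom c p.
    by apply: open_nbhs_nbhs; split=> //; exact: chart_dom_open.
  have n2 : \forall p \near val q, `|c (val q) - c p| < r.
    have := chart_map_continuous cq; rewrite /prop_for /continuous_at.
    by move=> /cvgrPdist_lt/(_ _ r0).
  by near=> p; split; near: p.
apply: filterS nr => p [cp pr].
pose z (t : @std_simplex R 1) := c (val q) + (val t) 0 ord_max *: (c p - c (val q)).
have zr t : `|c (val q) - z t| < r.
  have [t0 t1] := set_valP t.
  have tm0 := t0 ord_max.
  have tm1 : val t 0 ord_max <= 1.
    by rewrite -t1 (bigD1 ord_max)//= lerDl; apply: sumr_ge0 => j _; exact: t0.
  rewrite /z opprD addNKr normrN normrZ ger0_norm// distrC.
  by rewrite (le_lt_trans _ pr)// ler_piMl.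
have zP t : C (chart_inv c (z t)) /\ 0 < F (chart_inv c (z t)).
  by have [] := rP _ (zr t).
have zA t : chart_img c (z t) by have [] := rP _ (zr t).
pose s0 (t : @std_simplex R 1) : C := SigSub (mem_set (zP t).1).
have s0c : continuous s0.
  apply: continuous_into_subtype => t.
  have cz : {for t, continuous z}.
    have k : {for t, continuous (fun _ : @std_simplex R 1 => c (val q))}.
      exact: cst_continuous.
    have cv : {for t, continuous (fun t : @std_simplex R 1 => (val t) 0 ord_max)}.
      have cv : {for t, continuous (val : @std_simplex R 1 -> 'rV[R]_2)}.
        exact: val_continuous.
      exact: (continuous_comp cv (@coord_continuous _ _ _ 0 ord_max (val t))).
    have cw := continuous_comp cv
      (@scalel_continuous _ _ (c p - c (val q)) ((val t) 0 ord_max)).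
    exact: (continuousD k cw).
  exact: (continuous_comp cz (chart_inv_continuous (zA t))).
have vE (i : 'I_2) : val (face i (point0 R)) = delta_mx 0 (fintype.lift i ord0).
  by apply: face_delta; apply/rowP => m; rewrite ord1 !mxE.
exists (mkcts s0c); split.
- apply: val_inj; rewrite /= /z vE mxE [_ && _](_ : _ = false)//.
  by rewrite scale0r addr0 chart_mapK.
- rewrite /= /z vE mxE [_ && _](_ : _ = true)//.
  by rewrite scale1r addrC subrK chart_mapK.
- by move=> t; have [_] := zP t.
Unshelve. all: by end_near. Qed.

Hypothesis C_x0 : C x0.
Hypothesis C_betti1 : betti1 R C = 0%E.

Let base : C := SigSub (mem_set C_x0).
Let aC (x : C) := a (val x).
Let bC (x : C) := b (val x).

Let aC_cont : continuous aC.
Proof.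
move=> x; have cv : {for x, continuous (val : C -> M)} by exact: val_continuous.
exact: (continuous_comp cv (a_cont (x := val x))).
Qed.

Let bC_cont : continuous bC.
Proof.
move=> x; have cv : {for x, continuous (val : C -> M)} by exact: val_continuous.
exact: (continuous_comp cv (b_cont (x := val x))).
Qed.

Let abC_neq0 (x : C) : 0 < aC x * aC x + bC x * bC x.
Proof. exact/ab_neq0/set_valP. Qed.

Definition joined (x : C) (c : chain R C 1) :=
  boundary c = << simplex_point R x >> - << simplex_point R base >>.

Lemma joined_all (x : C) : exists c, joined x c.
Proof.
have step (q y : C) (s : singular_simplex R C 1) :
    s (face ord_max (point0 R)) = q -> s (face ord0 (point0 R)) = y ->
    (exists c, joined q c) <-> (exists c, joined y c).
  move=> sq sy; have bs := boundary1 sq sy; split=> -[c jc].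
    exists (c + << s >>); rewrite /joined /boundary fgliftD -/(boundary c) -/(boundary << s >>).
    by rewrite jc bs addrC subrKA.
  exists (c - << s >>); rewrite /joined /boundary fgliftB -/(boundary c) -/(boundary << s >>).
  by rewrite jc bs opprB addrC subrKA.
pose Z := [set p : M | exists y : C, val y = p /\ exists c, joined y c].
have ZC : Z `<=` C by move=> _ [y [<- _]]; exact: set_valP.
have near_Z (q : C) : \forall p \near val q, Z p <-> Z (val q).
  apply: filterS (chart_segment q) => p [s [sq sp _]].
  have h := step q (s (face ord0 (point0 R))) s sq erefl.
  split=> [[y [yp jy]]|[y [yq jy]]].
    by exists q; split=> //; apply/h; rewrite (_ : s _ = y)//; apply: val_inj; rewrite sp yp.
  exists (s (face ord0 (point0 R))); split=> //; apply/h.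
  by rewrite (_ : q = y)//; apply: val_inj.
have ZE : Z = C.
  apply: (component_connected (A := O) (x := x0)).
  - exists x0, base; split=> //; exists 0.
    by rewrite /joined subrr /boundary -[X in fglift _ X](subrr 0) fgliftB subrr.
  - exists (Z^°); first exact: open_interior.
    apply/seteqP; split=> [p Zp|p [_ /interior_subset]//].
    split; first exact: ZC.
    have [y [yp _]] := Zp; have := near_Z y; rewrite yp.
    by rewrite /interior/=; apply: filterS => p' [_ h]; exact: h.
  - exists (closure Z); first exact: closed_closure.
    apply/seteqP; split=> [p Zp|p [Cp cl]].
      by split; [exact: ZC|exact: subset_closure].
    have := near_Z (SigSub (mem_set Cp)) => /= /cl[p' [Zp' h]].
    exact/h.
have : Z (val x) by rewrite ZE; exact: set_valP.
by move=> [y [/val_inj ->]].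
Qed.

Lemma argument_exists : exists th : M -> R, forall q, C q ->
  \forall p \near q, C p /\ th p =
    th q + atan ((b p * a q - a p * b q) / (a p * a q + b p * b q)).
Proof.
pose w := winding aC_cont bC_cont abC_neq0.
pose thC (x : C) : R := w (sval (cid (joined_all x))).
have thE x c : joined x c -> thC x = w c.
  move=> jc; rewrite /thC; case: cid => c' jc' /=.
  by apply: winding_path => //; rewrite jc jc'.
exists (fun p => if pselect (C p) is left Cp then thC (SigSub (mem_set Cp)) else 0).
move=> q Cq; pose q' : C := SigSub (mem_set Cq).
apply: filterS (chart_segment q') => p [s [sq sp hs]].
have Cp : C p by rewrite -sp; exact: set_valP.
split=> //; case: pselect => // Cp'; case: pselect => // Cq'.
have pE : SigSub (mem_set Cp') = s (face ord0 (point0 R)) :> C.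
  by apply: val_inj; rewrite sp.
have qE : SigSub (mem_set Cq') = q' :> C by exact: val_inj.
rewrite pE qE; have [c jc] := joined_all q'.
rewrite (thE _ _ jc) (thE _ (c + << s >>)); last first.
  rewrite /joined /boundary fgliftD -/(boundary c) -/(boundary << s >>).
  by rewrite jc (boundary1 sq erefl) addrC subrKA.
rewrite /w /winding fgliftD fglift1; congr (_ + _).
rewrite arg_increment_half_plane => [|t]; last by rewrite sq; exact: hs.
by rewrite sq /aC /bC sp.
Qed.

End argument_on_component.

(** * Proof of the theorem *)

Lemma is_derive_cutoff_exp_arg (R : realType) (V : normedModType R)
    (N p d : V -> R) (y v : V) (dN dp dd a1 a2 th : R) :
  is_derive y v N dN -> is_derive y v p dp -> is_derive y v d dd -> d y != 0 ->
  is_derive y v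
    (fun z => (N z - a1) * (a2 - N z) * expR (th + atan (p z / d z)))
    ((N y - a1) * (a2 - N y) * (expR (th + atan (p y / d y)) *
      ((1 + (p y / d y) ^+ 2)^-1 * (p y * (- (d y) ^- 2 * dd) + (d y)^-1 * dp)))
     + expR (th + atan (p y / d y)) * ((a1 + a2 - 2 * N y) * dN)).
Proof.
move=> hN hp hd d0.
have k (r : R) : is_derive y v (fun _ : V => r) 0 by exact: is_derive_cst.
have di : is_derive y v (fun z => (d z)^-1) (- (d y) ^- 2 * dd).
  have [dy e] := hd; split; first exact: derivableV.
  by rewrite deriveV// e.
have dr : is_derive y v (fun z => p z / d z)
    (p y * (- (d y) ^- 2 * dd) + (d y)^-1 * dp) := is_deriveM hp di.
have dt := is_derive_comp_scalar dr (is_derive1_atan (p y / d y)).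
have dT : is_derive y v (fun z => th + atan (p z / d z)) _ := is_deriveD (k th) dt.
have dE := is_derive_comp_scalar dT (is_derive_expR (th + atan (p y / d y))).
have d1 : is_derive y v (fun z => N z - a1) _ := is_deriveB hN (k a1).
have d2 : is_derive y v (fun z => a2 - N z) _ := is_deriveB (k a2) hN.
have dP : is_derive y v (fun z => (N z - a1) * (a2 - N z)) _ := is_deriveM d1 d2.
have dF : is_derive y v
  (fun z => (N z - a1) * (a2 - N z) * expR (th + atan (p z / d z))) _ := is_deriveM dP dE.
apply: (is_derive_eq dF); rewrite /GRing.scale/= add0r.
congr (_ + _ * _); rewrite subr0 sub0r.
by move: (N y) => r; ring.
Qed.

Lemma cutoff_exp_arg_critical (R : realType) (n : nat) (M : smooth_manifold R n)
    (g : riemannian_metric M) (lambda mu : R[i]) (f : M -> R[i])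
    (c : chart R n M) (q : M) (a1 a2 th : R) (k : 'I_n) :
  eigenfunction g lambda mu f -> atlas c -> chart_dom c q ->
  0 < abs2 f q ->
  let a p := complex.Re (f p) in let b p := complex.Im (f p) in
  let G p := (abs2 f p - a1) * (a2 - abs2 f p) *
    expR (th + atan ((b p * a q - a p * b q) / (a p * a q + b p * b q))) in
  (\forall p \near q, G p <= G q) ->
  (abs2 f q - a1) * (a2 - abs2 f q) / abs2 f q * darg f c q 0 k
  + 2 * (a1 + a2 - 2 * abs2 f q) * dlogabs f c q 0 k = 0.
Proof.
move=> f_eigen ac cq N0 a b G Gmax.
have oA : open (chart_img c) := @chart_img_open _ _ _ c.
have Ax := chart_img_at cq.
pose A0 := a q; pose B0 := b q.
pose pr y := im_rep c f y * A0 - re_rep c f y * B0.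
pose dr y := re_rep c f y * A0 + im_rep c f y * B0.
have kst y (r : R) : is_derive y (delta_mx 0 k : 'rV[R]_n) (fun _ : 'rV[R]_n => r) 0.
  exact: is_derive_cst.
have dpr y : chart_img c y -> is_derive y (delta_mx 0 k) pr
    (A0 * partial k (im_rep c f) y - B0 * partial k (re_rep c f) y).
  move=> Ay; have da := Ck_on_is_partial k (re_rep_Ck f_eigen 1 ac) Ay.
  have db := Ck_on_is_partial k (im_rep_Ck f_eigen 1 ac) Ay.
  apply: (is_derive_eq (is_deriveB (is_deriveM db (kst y A0)) (is_deriveM da (kst y B0)))).
  by rewrite !scaler0 !add0r.
have ddr y : chart_img c y -> is_derive y (delta_mx 0 k) dr
    (A0 * partial k (re_rep c f) y + B0 * partial k (im_rep c f) y).
  move=> Ay; have da := Ck_on_is_partial k (re_rep_Ck f_eigen 1 ac) Ay.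
  have db := Ck_on_is_partial k (im_rep_Ck f_eigen 1 ac) Ay.
  apply: (is_derive_eq (is_deriveD (is_deriveM da (kst y A0)) (is_deriveM db (kst y B0)))).
  by rewrite !scaler0 !add0r.
have dN y : chart_img c y -> is_derive y (delta_mx 0 k) (abs2_rep f c)
    (partial k (abs2_rep f c) y).
  by move=> Ay; exact: Ck_on_is_partial (abs2_rep_Ck f_eigen 1 ac) Ay.
have drq : dr (c q) = abs2 f q.
  by rewrite /dr /re_rep /im_rep chart_mapK// /abs2 !expr2.
have prq : pr (c q) = 0.
  by rewrite /pr /re_rep /im_rep chart_mapK// /A0 /B0 /a /b mulrC subrr.
pose u y := (abs2_rep f c y - a1) * (a2 - abs2_rep f c y) *
    expR (th + atan (pr y / dr y)).
have du y : chart_img c y -> dr y != 0 -> is_derive y (delta_mx 0 k) u _ :=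
  fun Ay d0 => is_derive_cutoff_exp_arg a1 a2 th (dN y Ay) (dpr y Ay) (ddr y Ay) d0.
have umax : \forall y \near c q, u y <= u (c q).
  have uG y : u y = G (chart_inv c y) by rewrite /u /G abs2_repE.
  have := chart_near cq Gmax; apply: filterS => y.
  by rewrite !uG chart_mapK.
have near_d : \forall y \near c q, derivable u y (delta_mx 0 k).
  have n1 := near_open oA Ax.
  have n2 : \forall y \near c q, 0 < dr y.
    have cd : {for c q, continuous dr}.
      have ca := Ck_on_continuous (re_rep_Ck f_eigen 0 ac) Ax.
      have cb := Ck_on_continuous (im_rep_Ck f_eigen 0 ac) Ax.
      have kc (r : R) : {for c q, continuous (fun _ : 'rV[R]_n => r)}.
        exact: cst_continuous.
      exact: (continuousD (continuousM ca (kc A0)) (continuousM cb (kc B0))).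
    by rewrite -drq in N0; have := cd _ (lt_nbhsr N0).
  apply: filterS2 n1 n2 => y Ay d0.
  exact: (ex_derive_of (du y Ay (lt0r_neq0 d0))).
have := derive_local_max umax near_d.
have d0 : dr (c q) != 0 by rewrite drq gt_eqF.
rewrite (derive_val_of (du (c q) Ax d0)).
rewrite prq drq !mul0r atan0 addr0 add0r expr0n/= addr0 invr1 mul1r.
rewrite abs2_repE chart_mapK//.
have -> : partial k (abs2_rep f c) (c q) = 2 * dlogabs f c q 0 k.
  exact: (derive_val_of (partial_abs2_rep f_eigen k ac cq)).
have -> : A0 * partial k (im_rep c f) (c q) - B0 * partial k (re_rep c f) (c q) =
    darg f c q 0 k.
  by rewrite /darg re_rep_at// im_rep_at// !mxE mulNr.
rewrite mulrCA -mulrDr => /eqP; rewrite mulf_eq0 gt_eqF ?expR_gt0//= => /eqP <-.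
by rewrite !mulrA [_ * 2]mulrC.
Qed.

Theorem theorem6 (R : realType) (n : nat) (M : smooth_manifold R n)
    (g : riemannian_metric M) (lambda mu : R[i]) (f : M -> R[i])
    (r1 r2 : \bar R)
    (M_closed : closed_manifold M)
    (f_eigen : eigenfunction g lambda mu f)
    (f_neq0 : exists x, f x <> 0)
    (f_nonconst : ~ (forall x, \forall y \near x, f y = f x))
    (r1_ge0 : (0 <= r1)%E)
    (r1_lt_r2 : (r1 < r2)%E) :
  forall x : M,
    let C := connected_component
      [set y : M | (r1 < (ComplexField.Normc.normc (f y))%:E < r2)%E] x in
    C = set0 \/ betti1 R C <> 0%E.
Proof.
move=> x; set O := [set y : M | _]; move=> C.
have [Ox|Ox] := pselect (O x); last by left; exact: connected_component_out.
right => bC.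
have normcE y : ComplexField.Normc.normc (f y) = Num.sqrt (abs2 f y).
  by rewrite /abs2; case: (f y).
have abs2_cont := abs2_continuous f_eigen.
have O_open : open O.
  have -> : O = (fun y => Num.sqrt (abs2 f y)) @^-1`
      ([set t : R | r1 < t%:E]%E `&` [set t : R | t%:E < r2]%E).
    by apply/seteqP; split=> y; rewrite /O /= normcE; [move=> /andP[]|move=> [-> ->]].
  apply: open_comp => [y _|]; last first.
    by apply: openI; [exact: open_ereal_gt|exact: open_ereal_lt].
  exact: (continuous_comp (abs2_cont y) (@sqrt_continuous R (abs2 f y))).
have [s1 [s2 [s10 s1x sx2 sP]]] : exists s1 s2 : R, [/\ 0 < s1,
    s1 < Num.sqrt (abs2 f x), Num.sqrt (abs2 f x) < s2 &
    forall s, s1 <= s <= s2 -> (r1 < s%:E < r2)%E].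
  move: Ox; rewrite /O/= normcE; move: (Num.sqrt _) => s /andP[].
  case Er1 : r1 r1_ge0 => [t1| |]; [|by []|by []]; rewrite lee_fin lte_fin => t10.
  move=> t1s sr2.
  have [s2 ss2 s2r] : exists2 s2, s < s2 & (s2%:E < r2)%E.
    case Er2 : r2 sr2 => [t2| |//]; last by exists (s + 1); rewrite ?ltrDl ?ltry.
    rewrite lte_fin => st2; exists ((s + t2) / 2); first by rewrite midf_lt.
    by rewrite lte_fin midf_lt.
  exists ((t1 + s) / 2), s2; split=> //.
  - by rewrite divr_gt0// ltr_wpDl// (le_lt_trans t10).
  - by rewrite midf_lt.
  - move=> s' /andP[h1 h2]; rewrite lte_fin (lt_le_trans (midf_lt t1s).1)//=.
    by rewrite (le_lt_trans _ s2r)// lee_fin.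
pose a1 := s1 ^+ 2; pose a2 := s2 ^+ 2.
have abs2_sqrt y : abs2 f y = Num.sqrt (abs2 f y) ^+ 2.
  by rewrite sqr_sqrtr// abs2_ge0.
have s20 : 0 < s2 by rewrite (lt_trans s10)// (lt_trans s1x).
have rangeO y : a1 <= abs2 f y <= a2 -> O y.
  rewrite abs2_sqrt !ler_pXn2r ?nnegrE ?sqrtr_ge0 ?(ltW s10) ?(ltW s20)// => h.
  by rewrite /O/= normcE; exact: sP.
have xI : a1 < abs2 f x < a2.
  by rewrite abs2_sqrt !ltr_pXn2r ?nnegrE ?sqrtr_ge0 ?(ltW s10) ?(ltW s20)// s1x.
have Cx : C x by exact: connected_component_refl.
pose a p := complex.Re (f p); pose b p := complex.Im (f p).
have O_neq0 y : O y -> 0 < abs2 f y.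
  rewrite /O/= normcE => /andP[r1y _]; rewrite -sqrtr_gt0 -lte_fin.
  exact: le_lt_trans r1y.
have ab_neq0 y : C y -> 0 < a y * a y + b y * b y.
  by move=> /connected_component_sub/O_neq0; rewrite /abs2 !expr2.
have [th thP] := argument_exists O_open (re_continuous f_eigen)
  (im_continuous f_eigen) ab_neq0 Cx bC.
pose K := C `&` [set y | a1 <= abs2 f y <= a2].
have clK : closed K.
  have cl2 : closed [set y | a1 <= abs2 f y <= a2].
    have -> : [set y | a1 <= abs2 f y <= a2] =
        abs2 f @^-1` ([set t | a1 <= t] `&` [set t | t <= a2]).
      by apply/seteqP; split=> y /=; [move=> /andP[]|move=> [-> ->]].
    apply: closed_comp => [y _|]; first exact: abs2_cont.
    by apply: closedI; [exact: closed_ge|exact: closed_le].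
  move=> y Ky; have yI : a1 <= abs2 f y <= a2.
    by apply: cl2; apply: closureS Ky => t [].
  split=> //; apply: (component_closure O_open (rangeO y yI)).
  by apply: closureS Ky => t [].
have cK : compact K by apply: subclosed_compact M_closed _.
pose rt q p := atan ((b p * a q - a p * b q) / (a p * a q + b p * b q)).
have rtq q : rt q q = 0 by rewrite /rt [b q * _]mulrC subrr mul0r atan0.
have th_cont q : C q -> {for q, continuous th}.
  move=> Cq; apply: (@near_eq_continuous _ _ (fun p => th q + rt q p)).
    by apply: filterS (thP q Cq) => p [_ ->].
  have ca : {for q, continuous a} by exact: (re_continuous f_eigen).
  have cb : {for q, continuous b} by exact: (im_continuous f_eigen).
  apply: arg_step_continuous => //.
  by rewrite gt_eqF// ab_neq0.
pose G p := (abs2 f p - a1) * (a2 - abs2 f p) * expR (th p).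
have Gc : {within K, continuous G}.
  apply: continuous_in_subspaceT => q; rewrite inE => -[Cq _].
  have kc (r : R) : {for q, continuous (fun _ : M => r)} by exact: cst_continuous.
  have cN : {for q, continuous (abs2 f)} by exact: abs2_cont.
  have cE : {for q, continuous (fun p => expR (th p))}.
    exact: (continuous_comp (th_cont q Cq) (@continuous_expR R (th q))).
  have cP : {for q, continuous (fun p => (abs2 f p - a1) * (a2 - abs2 f p))}.
    exact: (continuousM (continuousB cN (kc a1)) (continuousB (kc a2) cN)).
  exact: (continuousM cP cE).
have Kx : K x by split=> //; case/andP: xI => /ltW h1 /ltW h2; rewrite /= h1.
have [q qK qmax] := compact_EVT_max (ex_intro _ x Kx) cK Gc.
rewrite inE in qK; have [Cq /andP[aq1 aq2]] := qK.
have G0 : 0 < (abs2 f q - a1) * (a2 - abs2 f q).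
  rewrite -(pmulr_lgt0 _ (expR_gt0 (th q))) -/(G q).
  apply: lt_le_trans (qmax x _); last by rewrite inE.
  case/andP: xI => x1 x2.
  by rewrite /G !mulr_gt0 ?subr_gt0 ?expR_gt0.
have q1 : a1 < abs2 f q.
  by rewrite -subr_gt0 lt_neqAle subr_ge0 aq1 andbT; apply: contraTneq G0 => <-; rewrite mul0r ltxx.
have q2 : abs2 f q < a2.
  by rewrite -subr_gt0 lt_neqAle subr_ge0 aq2 andbT; apply: contraTneq G0 => <-; rewrite mulr0 ltxx.
have N0 : 0 < abs2 f q by apply: O_neq0; exact: connected_component_sub Cq.
have Gmax : \forall p \near q,
    (abs2 f p - a1) * (a2 - abs2 f p) * expR (th q + rt q p) <=
    (abs2 f q - a1) * (a2 - abs2 f q) * expR (th q + rt q q).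
  have n1 : \forall p \near q, a1 < abs2 f p by have := abs2_cont q _ (lt_nbhsr q1).
  have n2 : \forall p \near q, abs2 f p < a2 by have := abs2_cont q _ (lt_nbhsl q2).
  have n3 := thP q Cq.
  near=> p.
  have [Cp thp] : C p /\ th p = th q + rt q p by near: p.
  rewrite rtq addr0 -thp -/(G p) -/(G q); apply: qmax; rewrite inE; split=> //=.
  by apply/andP; split; apply: ltW; near: p.
have [c ac cq] := atlas_cover q.
have Ax := chart_img_at cq.
have [mui mur] := eigen_mu_le0 f_eigen M_closed f_neq0.
have mur_lt0 : complex.Re mu < 0.
  rewrite lt_neqAle mur andbT; apply/eqP => mur0; apply: f_nonconst.
  apply: (eigen_locally_constant f_eigen M_closed f_neq0).
  by case: mu mui mur0 {f_eigen mur} => u v /= -> ->.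
pose al := (abs2 f q - a1) * (a2 - abs2 f q) / abs2 f q.
pose be := 2 * (a1 + a2 - 2 * abs2 f q).
have XY : al *: darg f c q + be *: dlogabs f c q = 0.
  apply/rowP => k; rewrite mxE [X in X + _]mxE [X in _ + X]mxE [RHS]mxE.
  exact: (cutoff_exp_arg_critical k f_eigen ac cq N0 Gmax).
have cross : gform g c (c q) (dlogabs f c q) (darg f c q) = 0.
  have := dlogabs_darg_cross f_eigen ac cq; rewrite mui mul0r => /eqP.
  by rewrite mulf_eq0 pnatr_eq0/= => /eqP.
have al0 : 0 < al by rewrite divr_gt0.
have Y0 : darg f c q = 0.
  apply: (gform_eq0 ac Ax (g := g)); apply: (mulfI (lt0r_neq0 al0)).
  have : gform g c (c q) (al *: darg f c q + be *: dlogabs f c q) (darg f c q) = 0.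
    by rewrite XY (gformC g ac)// gform0.
  by rewrite gformDl !gformZl cross !mulr0 addr0.
have := dlogabs_darg_diff f_eigen ac cq; rewrite Y0 gform0 subr0 => e.
have := gform_ge0 g ac (dlogabs f c q) Ax; rewrite e leNgt.
by rewrite nmulr_rlt0// exprn_gt0.
Unshelve. all: by end_near. Qed.
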